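(* Let $K:\mathbb B_d\times\mathbb B_d\to\mathcal M_d(\mathbb C)$ be a sesqui-analytic Hermitian function which is quasi-invariant with multiplier $c(u)=u$, i.e. $$u\,K(u^{-1}\cdot\boldsymbol z,u^{-1}\cdot\boldsymbol w)\,u^*=K(\boldsymbol z,\boldsymbol w)\quad\text{for all }u\in\mathcal U(d),\ \boldsymbol z,\boldsymbol w\in\mathbb B_d.$$ Then there are complex numbers $\alpha_j$ ($j\geq0$) and $\beta_j$ ($j\geq1$) such that $$K(\boldsymbol z,\boldsymbol w)=\sum_{j=0}^\infty\alpha_j\hat K_j(\boldsymbol z,\boldsymbol w)+\sum_{j=1}^\infty\beta_j\hat K_j^\perp(\boldsymbol z,\boldsymbol w).$$
   Context: $\mathbb B_d$ is the open unit ball of $\mathbb C^d$, $\mathcal U(d)$ the unitary group, $\langle\boldsymbol z,\boldsymbol w\rangle=\sum_i z_i\bar w_i$. Sesqui-analytic means holomorphic in $\boldsymbol z$ and anti-holomorphic in $\boldsymbol w$; Hermitian means $K(\boldsymbol z,\boldsymbol w)^*=K(\boldsymbol w,\boldsymbol z)$. $\mathcal P_\ell$ denotes homogeneous polynomials of degree $\ell$ in $d$ variables with the Fischer–Fock inner product ($\langle\boldsymbol z^\alpha,\boldsymbol z^\beta\rangle=\alpha!\,\delta_{\alpha\beta}$), and $\mathbb C^d\otimes\mathcal P_\ell$ carries the tensor product inner product. Let $\hat{\mathcal V}_\ell=\{f=(f_1,\ldots,f_d)\in\mathbb C^d\otimes\mathcal P_\ell:\partial_1f_1+\cdots+\partial_df_d=0\}$,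 $\hat K_\ell$ its reproducing kernel and $\hat K_\ell^\perp$ the reproducing kernel of its orthogonal complement in $\mathbb C^d\otimes\mathcal P_\ell$. Explicitly $\hat K_0=I_d$, and for $\ell\ge1$, $\hat K_\ell(\boldsymbol z,\boldsymbol w)=\frac{1}{(\ell+d-1)(\ell-1)!}\langle\boldsymbol z,\boldsymbol w\rangle^{\ell-1}\big(\frac{\ell+d-1}{\ell}\langle\boldsymbol z,\boldsymbol w\rangle I_d-\boldsymbol z\bar{\boldsymbol w}^\dagger\big)$ and $\hat K_\ell^\perp(\boldsymbol z,\boldsymbol w)=\frac{1}{(\ell+d-1)(\ell-1)!}\langle\boldsymbol z,\boldsymbol w\rangle^{\ell-1}\boldsymbol z\bar{\boldsymbol w}^\dagger$, where $\boldsymbol z\bar{\boldsymbol w}^\dagger$ is the matrix with $(i,j)$ entry $z_i\bar w_j$. *)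

(* Defs.v *)
(* MathComp + MathComp-Analysis; complex numbers are R[i] (real_closed)
   for an arbitrary R : realType. *)
From HB Require Import structures.
From mathcomp Require Import all_boot all_order all_algebra.
From mathcomp Require Import all_classical all_reals all_analysis.
From mathcomp Require Import complex.
Set Implicit Arguments. Unset Strict Implicit. Unset Printing Implicit Defensive.
Import Order.TTheory GRing.Theory Num.Theory.
Import numFieldNormedType.Exports.
Local Open Scope ring_scope.
Local Open Scope classical_set_scope.

(* R[i] as a normed module over itself (complex scalars), via R[i]^o *)
HB.instance Definition _ (R : realType) := GRing.ComAlgebra.copy R[i] R[i]^o.
HB.instance Definition _ (R : realType) := Vector.copy R[i] R[i]^o.
HB.instance Definition _ (R : realType) := NormedModule.copy R[i] R[i]^o.

Section Defs.
Variable R : realType.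
Local Notation C := (R[i]).

(* conjugate transpose A^* *)
Definition adjmx m n (A : 'M[C]_(m, n)) : 'M[C]_(n, m) :=
  (map_mx (fun x : C => x^*) A)^T.

(* <z, w> = sum_i z_i conj(w_i), for column vectors *)
Definition cinner d (z w : 'cV[C]_d) : C := \sum_(i < d) z i 0 * (w i 0)^*.

(* the open unit ball B_d *)
Definition cball d : set 'cV[C]_d := [set z | \sum_(i < d) `|z i 0| ^+ 2 < 1].

(* the unitary group U(d) *)
Definition unitary d : set 'M[C]_d := [set u | u *m adjmx u = 1%:M].

(* standard basis vector e_i *)
Definition evec d (i : 'I_d) : 'cV[C]_d := delta_mx i 0.

(* sesqui-analytic on B_d x B_d: jointly continuous, complex-differentiable in each
   z_i and in each conj(w_i) (Osgood's definition of holomorphy in several variables,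
   holomorphic in z and anti-holomorphic in w). *)
Definition sesqui_analytic d (K : 'cV[C]_d -> 'cV[C]_d -> 'M[C]_d) : Prop :=
  forall z w, cball z -> cball w ->
    [/\ {for (z, w), continuous (fun p : 'cV[C]_d * 'cV[C]_d => K p.1 p.2)},
        (forall i : 'I_d, derivable (fun t : C => K (z + t *: evec i) w) 0 1) &
        (forall i : 'I_d, derivable (fun t : C => K z (w + t^* *: evec i)) 0 1)].

Definition hermitian_kernel d (K : 'cV[C]_d -> 'cV[C]_d -> 'M[C]_d) : Prop :=
  forall z w, cball z -> cball w -> adjmx (K z w) = K w z.

(* quasi-invariance with multiplier c(u) = u *)
Definition quasi_invariant_id d (K : 'cV[C]_d -> 'cV[C]_d -> 'M[C]_d) : Prop :=
  forall u z w, unitary u -> cball z -> cball w ->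
    u *m K (invmx u *m z) (invmx u *m w) *m adjmx u = K z w.

(* \hat K_l, explicit formula *)
Definition Khat d (l : nat) (z w : 'cV[C]_d) : 'M[C]_d :=
  match l with
  | 0 => 1%:M
  | l'.+1 =>
      ((l' + d)%:R * (l'`!)%:R)^-1 * cinner z w ^+ l' *:
        (((l' + d)%:R / l'.+1%:R * cinner z w) *: 1%:M - z *m adjmx w)
  end.

(* \hat K_l^perp, explicit formula (l >= 1; value at l = 0 unused) *)
Definition Khatperp d (l : nat) (z w : 'cV[C]_d) : 'M[C]_d :=
  match l with
  | 0 => 0
  | l'.+1 => ((l' + d)%:R * (l'`!)%:R)^-1 * cinner z w ^+ l' *: (z *m adjmx w)
  end.

End Defs.

(* Main.v *)
(** A kernel satisfying the invariance condition is determined by its values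
at [w] on the first coordinate axis, since the unitary group moves any [w]
there.  Holomorphic functions on a disc that are homogeneous on the unit circle
of a coordinate are homogeneous inside it, so the diagonal torus fixing [w]
forces every off-diagonal entry outside the first column of [K z w] to vanish
and makes the diagonal entries depend on [z_0 * conj w_0] alone.  The Hermitian
symmetry gives the same information on rows with [z] in place of [w], and
together these say that [K z w - al I] is a multiple of [z w^*].  Hence
[K z w = a(<z, w>) I + g(<z, w>) z w^*] with [a], [g] power series on the unit
disc, and comparing with the explicit [Khat], [Khatperp] yields the
coefficients.

Only complex differentiability is available, so the power series come from
Goursat's lemma (by bisection of rectangles, with integrals replaced by
differences of antiderivatives) and Cauchy's formula on circles. *)
Require Import Defs.
From HB Require Import structures.
From mathcomp Require Import all_boot all_order all_algebra.
From mathcomp Require Import all_classical all_reals all_analysis.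
From mathcomp Require Import perm complex ring lra.
Import Order.TTheory GRing.Theory Num.Theory.
Import numFieldNormedType.Exports.
Import ComplexField.Normc.
Local Open Scope ring_scope.
Local Open Scope classical_set_scope.
Set Implicit Arguments.
Unset Strict Implicit.
Unset Printing Implicit Defensive.

(** The stabiliser of a nonzero point [w] of the axis consists of the unitary maps of the remaining
    coordinates, and alone it does not relate the first column of [K z w] to the diagonal. The
    relation comes from a unitary that takes [z], rather than [w], to the axis. It is obtained in
    cross-multiplied form, with a factor [z_0], and cancelling this factor is the delicate point.
    The two diagonal series must have the same constant term, so that their difference is divisible
    by [z_0 * conj w_0], and the points with [z_0 = 0] are reached by continuity. The argument
    compares two diagonal entries, hence dimension one is treated apart; there [I] and [z w^*] are
    both scalars and the splitting is a choice.

    Each [Khat] mixes [I] with [z w^*], so the series in [Khat] also produces a multiple of [z w^*],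
    for which the series in [Khatperp] compensates. Both series must converge separately; this
    multiple is therefore summed on its own, by absolute convergence. *)

Local Notation Re := complex.Re.
Local Notation Im := complex.Im.

(** * Modulus and bisection *)

Section Norm.
Variable R : realType.
Local Notation C := R[i].
Local Notation N := (@normc R).
Local Notation rc := (real_complex R).

Lemma normc_ge0 (z : C) : 0 <= N z.
Proof. by case: z => a b; exact: sqrtr_ge0. Qed.

Lemma normc_rc (x : R) : N (rc x) = `|x|.
Proof. by rewrite /= expr0n addr0 sqrtr_sqr. Qed.

Lemma normc_i : N 'i%C = 1.
Proof. by rewrite /= expr0n add0r expr1n sqrtr1. Qed.

Lemma normcB (x y : C) : N (x - y) <= N x + N y.
Proof. by rewrite -(normcN y) le_normcD. Qed.

Lemma normcC (x y : C) : N (x - y) = N (y - x).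
Proof. by rewrite -(normcN (y - x)) opprB. Qed.

Lemma normcX (z : C) n : N (z ^+ n) = N z ^+ n.
Proof. by elim: n => [|n IH]; rewrite ?normc1// !exprS normcM IH. Qed.

Lemma normc_eq0 (z : C) : (N z == 0) = (z == 0).
Proof.
by apply/eqP/eqP => [/eq0_normc //|->]; rewrite normc0.
Qed.

Lemma normc_gt0 (z : C) : (0 < N z) = (z != 0).
Proof. by rewrite lt_neqAle normc_ge0 andbT eq_sym normc_eq0. Qed.

Lemma normc_Re (z : C) : `|Re z| <= N z.
Proof.
by case: z => a b /=; rewrite -[leLHS]sqrtr_sqr ler_wsqrtr// lerDl sqr_ge0.
Qed.

Lemma normc_Im (z : C) : `|Im z| <= N z.
Proof.
by case: z => a b /=; rewrite -[leLHS]sqrtr_sqr ler_wsqrtr// lerDr sqr_ge0.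
Qed.

Lemma normc_distD (x y z : C) : N (x - z) <= N (x - y) + N (y - z).
Proof. by rewrite -[x - z](subrKA y) le_normcD. Qed.

Lemma normc_sum (I : Type) (r : seq I) (F : I -> C) :
  N (\sum_(i <- r) F i) <= \sum_(i <- r) N (F i).
Proof.
elim: r => [|i r IH]; first by rewrite !big_nil normc0.
by rewrite !big_cons (le_trans (le_normcD _ _))// lerD2l.
Qed.

End Norm.

#[local] Arguments conjc : simpl never.
#[local] Arguments normc : simpl never.
#[local] Arguments real_complex_def : simpl never.

Section Bisection.
Variable R : realType.
Implicit Types (a b c x y : R).

(** The endpoints are unordered, so that rectangles carry an orientation. *)
Definition btw a b c := a <= c <= b \/ b <= c <= a.

Lemma btwxx a b : btw a b a.
Proof. by case: (leP a b) => [|/ltW] h; [left|right]; rewrite lexx h. Qed.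

Lemma btwyy a b : btw a b b.
Proof. by case: (leP a b) => [|/ltW] h; [left|right]; rewrite lexx h. Qed.

Lemma btw_trans a b c d x : btw a b c -> btw a b d -> btw c d x -> btw a b x.
Proof. by move=> [] /andP[? ?] [] /andP[? ?] [] /andP[? ?]; (left; lra) || (right; lra). Qed.

Lemma btw_dist a b c : btw a b c -> `|b - a| = `|b - c| + `|c - a|.
Proof.
case=> /andP[h1 h2].
  by rewrite !ger0_norm ?subr_ge0//; [ring|exact: le_trans h2].
by rewrite !ler0_norm ?subr_le0//; [ring|exact: le_trans h2].
Qed.

Lemma btw_half a b : btw a b ((a + b) / 2).
Proof. by case: (leP a b) => h; [left|right]; lra. Qed.

Lemma nested_btw (u v : nat -> R) :
  (forall n, btw (u n) (v n) (u n.+1)) ->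
  (forall n, btw (u n) (v n) (v n.+1)) ->
  exists c, forall n, btw (u n) (v n) c.
Proof.
move=> hu hv.
pose lo n := Num.min (u n) (v n); pose hi n := Num.max (u n) (v n).
have btwE a b x : btw a b x <-> Num.min a b <= x <= Num.max a b.
  rewrite /btw; split.
    by case=> /andP[h1 h2]; rewrite ge_min le_max h1 h2 ?orbT.
  by case: (leP a b) => _; [left|right].
have step n : lo n <= lo n.+1 /\ hi n.+1 <= hi n.
  have /btwE/andP[a1 a2] := hu n; have /btwE/andP[b1 b2] := hv n.
  by rewrite /lo /hi le_min ge_max a1 a2 b1 b2.
have lohi n : lo n <= hi n by rewrite /lo /hi ge_min le_max lexx.
have mon n k : lo n <= lo (n + k)%N /\ hi (n + k)%N <= hi n.
  elim: k => [|k [IH1 IH2]]; rewrite ?addn0// addnS.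
  by have [s1 s2] := step (n + k)%N; split; [exact: le_trans s1|exact: le_trans IH2].
have lh n m : lo n <= hi m.
  have [h1 _] := mon n m; have [_ h2] := mon m n.
  by rewrite (le_trans h1)// (le_trans (lohi _))// addnC.
exists (sup (range lo)) => n; apply/btwE; apply/andP; split.
  apply: ub_le_sup; last by exists n.
  by exists (hi 0%N) => _ [m _ <-].
by apply: ge_sup => [|_ [m _ <-]]; [exists (lo 0%N), 0%N|exact: lh].
Qed.

(** Compactness in the form of Cousin's lemma: if [P] fails on a rectangle, it fails on one of the
    four quarters, and the nested failing rectangles shrink to a point near which [P] holds.
    One-dimensional uses take a degenerate second interval. *)
Lemma bisect2 (P : R -> R -> R -> R -> Prop) x0 x1 y0 y1 :
  (forall u0 u1 v0 v1, let um := (u0 + u1) / 2 in let vm := (v0 + v1) / 2 in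
     P u0 um v0 vm -> P um u1 v0 vm -> P u0 um vm v1 -> P um u1 vm v1 ->
     P u0 u1 v0 v1) ->
  (forall cx cy, btw x0 x1 cx -> btw y0 y1 cy ->
     exists2 dl, 0 < dl & forall u0 u1 v0 v1,
       btw x0 x1 u0 -> btw x0 x1 u1 -> btw y0 y1 v0 -> btw y0 y1 v1 ->
       btw u0 u1 cx -> btw v0 v1 cy -> `|u1 - u0| < dl -> `|v1 - v0| < dl ->
       P u0 u1 v0 v1) ->
  P x0 x1 y0 y1.
Proof.
move=> split_P loc_P; apply: contrapT => nP.
pose T := (R * R * (R * R))%type.
pose Q (s : T) := P s.1.1 s.1.2 s.2.1 s.2.2.
have next (s : T) : {t : T | ~ Q s -> ~ Q t /\
    [/\ btw s.1.1 s.1.2 t.1.1, btw s.1.1 s.1.2 t.1.2,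
        btw s.2.1 s.2.2 t.2.1, btw s.2.1 s.2.2 t.2.2 &
        `|t.1.2 - t.1.1| = `|s.1.2 - s.1.1| / 2 /\
        `|t.2.2 - t.2.1| = `|s.2.2 - s.2.1| / 2]}.
  apply: cid; case: s => -[u0 u1] [v0 v1].
  (* [next] must be total: where [Q s] holds, the required implication is vacuous. *)
  have [?|nQ] := pselect (Q (u0, u1, (v0, v1))); first by exists (u0, u1, (v0, v1)).
  set um := (u0 + u1) / 2; set vm := (v0 + v1) / 2.
  have half (a b : R) : `|(a + b) / 2 - a| = `|b - a| / 2 /\
                        `|b - (a + b) / 2| = `|b - a| / 2.
    have -> : (a + b) / 2 - a = (b - a) / 2 by field.
    have -> : b - (a + b) / 2 = (b - a) / 2 by field.
    by rewrite normrM [`|2^-1|]ger0_norm// invr_ge0.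
  have [hu1 hu2] := half u0 u1; have [hv1 hv2] := half v0 v1.
  have [q1|?] := pselect (Q (u0, um, (v0, vm))); last first.
    exists (u0, um, (v0, vm)) => _; split=> //=.
    by split=> //; [exact: btwxx|exact: btw_half|exact: btwxx|exact: btw_half].
  have [q2|?] := pselect (Q (um, u1, (v0, vm))); last first.
    exists (um, u1, (v0, vm)) => _; split=> //=.
    by split=> //; [exact: btw_half|exact: btwyy|exact: btwxx|exact: btw_half].
  have [q3|?] := pselect (Q (u0, um, (vm, v1))); last first.
    exists (u0, um, (vm, v1)) => _; split=> //=.
    by split=> //; [exact: btwxx|exact: btw_half|exact: btw_half|exact: btwyy].
  have [q4|?] := pselect (Q (um, u1, (vm, v1))); last first.
    exists (um, u1, (vm, v1)) => _; split=> //=.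
    by split=> //; [exact: btw_half|exact: btwyy|exact: btw_half|exact: btwyy].
  by exfalso; apply: nQ; exact: split_P.
pose s n := iter n (fun t => sval (next t)) (x0, x1, (y0, y1)).
have nQ n : ~ Q (s n).
  by elim: n => [//|n IH]; have [] := svalP (next (s n)) IH.
have sP n := (svalP (next (s n)) (nQ n)).2.
have [cx hcx] : exists c, forall n, btw (s n).1.1 (s n).1.2 c.
  by apply: nested_btw => n; have [] := sP n.
have [cy hcy] : exists c, forall n, btw (s n).2.1 (s n).2.2 c.
  by apply: nested_btw => n; have [] := sP n.
have sub n : [/\ btw x0 x1 (s n).1.1, btw x0 x1 (s n).1.2,
    btw y0 y1 (s n).2.1 & btw y0 y1 (s n).2.2].
  elim: n => [|n [a1 a2 a3 a4]]; first by split; (exact: btwxx || exact: btwyy).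
  have [b1 b2 b3 b4 _] := sP n.
  by split; [exact: btw_trans a1 a2 b1|exact: btw_trans a1 a2 b2|
             exact: btw_trans a3 a4 b3|exact: btw_trans a3 a4 b4].
have size n : `|(s n).1.2 - (s n).1.1| = `|x1 - x0| / 2 ^+ n /\
              `|(s n).2.2 - (s n).2.1| = `|y1 - y0| / 2 ^+ n.
  elim: n => [|n [IH1 IH2]]; first by rewrite !expr0 !divr1.
  have [_ _ _ _ [e1 e2]] := sP n.
  by rewrite [LHS]e1 [X in _ /\ X = _]e2 IH1 IH2 exprSr !invfM !mulrA.
have [dl dl0 hdl] := loc_P cx cy (hcx 0%N) (hcy 0%N).
pose L := `|x1 - x0| + `|y1 - y0|.
have [n hn] : exists n, L / 2 ^+ n < dl.
  exists (Num.bound (L / dl)).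
  rewrite ltr_pdivrMr ?exprn_gt0// mulrC -ltr_pdivrMr//.
  by rewrite (lt_le_trans (archi_boundP _))// ?divr_ge0 ?addr_ge0 ?(ltW dl0)// -natrX ler_nat ltnW// ltn_expl.
have [b1 b2 b3 b4] := sub n; have [e1 e2] := size n.
apply: (nQ n); apply: hdl => //.
  by rewrite e1 (le_lt_trans _ hn)// ler_pM2r ?invr_gt0 ?exprn_gt0// lerDl.
by rewrite e2 (le_lt_trans _ hn)// ler_pM2r ?invr_gt0 ?exprn_gt0// lerDr.
Qed.

End Bisection.

(** * Derivatives and antiderivatives *)

Section Derivatives.
Variable R : realType.
Local Notation C := R[i].
Local Notation N := (@normc R).
Local Notation rc := (real_complex R).

(** Stated with the real-valued modulus and without a quotient: errors are then real numbers open to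
    linear arithmetic, and [y = x] needs no separate case. *)
Definition rderiv (H : R -> C) (x : R) (l : C) := forall e, 0 < e ->
  exists2 dl, 0 < dl & forall y, `|y - x| < dl ->
    N (H y - H x - rc (y - x) * l) <= e * `|y - x|.

Definition cderiv (f : C -> C) (p l : C) := forall e, 0 < e ->
  exists2 dl, 0 < dl & forall z, N (z - p) < dl ->
    N (f z - f p - l * (z - p)) <= e * N (z - p).

Definition ccont (f : C -> C) (p : C) := forall e, 0 < e ->
  exists2 dl, 0 < dl & forall z, N (z - p) < dl -> N (f z - f p) < e.

Definition rcont (h : R -> C) (x : R) := forall e, 0 < e ->
  exists2 dl, 0 < dl & forall y, `|y - x| < dl -> N (h y - h x) < e.

Lemma min_gt0 (a b : R) : 0 < a -> 0 < b -> 0 < Num.min a b.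
Proof. by move=> a0 b0; rewrite lt_min a0. Qed.

Lemma rderivD H K x l m : rderiv H x l -> rderiv K x m ->
  rderiv (fun y => H y + K y) x (l + m).
Proof.
move=> hH hK e e0; have e20 : 0 < e / 2 by rewrite divr_gt0.
have [d1 d10 h1] := hH _ e20; have [d2 d20 h2] := hK _ e20.
exists (Num.min d1 d2); first exact: min_gt0.
move=> y; rewrite lt_min => /andP[/h1 {}h1 /h2 {}h2].
have -> : H y + K y - (H x + K x) - rc (y - x) * (l + m) =
  (H y - H x - rc (y - x) * l) + (K y - K x - rc (y - x) * m) by ring.
by rewrite (le_trans (le_normcD _ _))//; lra.
Qed.

Lemma rderivZ H x l (a : C) : rderiv H x l -> rderiv (fun y => a * H y) x (a * l).
Proof.
move=> hH e e0; have a0 : 0 < N a + 1 by rewrite ltr_wpDl ?normc_ge0.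
have [d d0 h] := hH _ (divr_gt0 e0 a0).
exists d => // y /h {}h.
have -> : a * H y - a * H x - rc (y - x) * (a * l) =
  a * (H y - H x - rc (y - x) * l) by ring.
rewrite normcM (le_trans (ler_wpM2l (normc_ge0 _) h))// mulrA ler_wpM2r//.
by rewrite mulrCA ler_piMr ?(ltW e0)// ler_pdivrMr// mul1r lerDl.
Qed.

Lemma rderivB H K x l m : rderiv H x l -> rderiv K x m ->
  rderiv (fun y => H y - K y) x (l - m).
Proof.
move=> hH /(rderivZ (-1)) /(rderivD hH).
by rewrite mulN1r; under eq_fun do rewrite mulN1r.
Qed.

(** A complex-valued function has no mean value equality. The inequality with slack [k] holds on
    short intervals around each point and, lengths being additive under bisection, on the whole
    interval. *)
Lemma rderiv_bound H h a b M :
  (forall x, btw a b x -> rderiv H x (h x) /\ N (h x) <= M) ->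
  N (H b - H a) <= M * `|b - a|.
Proof.
move=> hH; apply/ler_addgt0Pr => e e0.
have c0 : 0 < `|b - a| + 1 by rewrite ltr_wpDl.
pose k := e / (`|b - a| + 1); have k0 : 0 < k by rewrite divr_gt0.
suff hk : N (H b - H a) <= (M + k) * `|b - a|.
  rewrite (le_trans hk)// mulrDl lerD2l /k mulrAC -mulrA ler_piMr ?(ltW e0)//.
  by rewrite ler_pdivrMr// mul1r lerDl.
apply: (@bisect2 _ (fun u v _ _ => N (H v - H u) <= (M + k) * `|v - u|) a b 0 0).
  move=> u v _ _ /= h1 h2 _ _.
  have -> : H v - H u = (H v - H ((u + v) / 2)) + (H ((u + v) / 2) - H u).
    by ring.
  rewrite (le_trans (le_normcD _ _))// (le_trans (lerD h2 h1))// -mulrDr.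
  by rewrite -(btw_dist (btw_half u v)).
move=> c c2 hc _; have [hd hM] := hH _ hc.
have [d d0 hd'] := hd _ k0; exists d => // u v _ _ _ _ _ _ hcuv _ uvd _.
have M0 : 0 <= M by rewrite (le_trans (normc_ge0 _) hM).
have key y : `|y - c| < d -> N (H y - H c) <= (M + k) * `|y - c|.
  move=> /hd' {}hd'; rewrite mulrDl.
  have -> : H y - H c = rc (y - c) * h c + (H y - H c - rc (y - c) * h c) by ring.
  rewrite (le_trans (le_normcD _ _))// lerD// normcM normc_rc mulrC.
  by rewrite ler_wpM2r.
have D := btw_dist hcuv.
have D1 := normr_ge0 (v - c); have D2 := normr_ge0 (c - u).
rewrite (le_trans (normc_distD _ (H c) _))// D mulrDr lerD ?key//; first lra.
by rewrite normcC distrC key// distrC; lra.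
Qed.

Lemma rderiv_unique H K h a b :
  (forall x, btw a b x -> rderiv H x (h x) /\ rderiv K x (h x)) ->
  H b - H a = K b - K a.
Proof.
move=> hHK; apply/eqP; rewrite -subr_eq0 -normc_eq0 eq_le normc_ge0 andbT.
have -> : H b - H a - (K b - K a) = (H b - K b) - (H a - K a) by ring.
rewrite (le_trans (@rderiv_bound (fun x => H x - K x) (fun=> 0) a b 0 _)) ?mul0r//.
move=> x /hHK[h1 h2]; rewrite normc0 lexx; split=> //.
by rewrite -(subrr (h x)); exact: rderivB.
Qed.

Lemma is_derive_rderiv (g : R -> R) (x l : R) :
  is_derive x (1 : R) g l -> rderiv (fun y => rc (g y)) x (rc l).
Proof.
move=> [dg gl] e e0.
have : (fun h => h^-1 *: (g (h *: (1 : R) + x) - g x)) @ 0^' --> l.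
  by rewrite -gl; exact: dg.
move=> /cvgrPdist_le /(_ _ e0); rewrite near_withinE.
move=> /nbhs_ballP[d /= d0 hd]; exists d => // y yd.
have [->|yx] := eqVneq y x.
  by rewrite !subrr raddf0 mul0r subr0 normc0 normr0 mulr0.
have /= := hd (y - x); rewrite /ball /= sub0r normrN subr_eq0 => /(_ yd yx).
rewrite [_ *: 1]mulr1 subrK => h.
rewrite -!rmorphB -rmorphM -rmorphB normc_rc.
have yx0 : y - x != 0 by rewrite subr_eq0.
have -> : g y - g x - (y - x) * l = - ((l - (y - x)^-1 * (g y - g x)) * (y - x)).
  by field.
by rewrite normrN normrM ler_wpM2r.
Qed.

Lemma rderiv_cart (G K : R -> R) x (l m : R) :
  is_derive x (1 : R) G l -> is_derive x (1 : R) K m ->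
  rderiv (fun y => rc (G y) + 'i%C * rc (K y)) x (rc l + 'i%C * rc m).
Proof.
by move=> /is_derive_rderiv h1 /is_derive_rderiv h2; apply/rderivD/rderivZ.
Qed.

Lemma real_antiderivative (g : R -> R) (a : R) : continuous g ->
  exists G : R -> R, forall x, a < x -> is_derive x (1 : R) G (g x).
Proof.
move=> cg; exists (fun x => \int[lebesgue_measure]_(t in [set` `[a, x]]) g t)%R.
move=> x ax.
have [] := @continuous_FTC1_closed R g a x (x + 1) _ _ ax (cg x).
- by rewrite ltrDl.
- apply: continuous_compact_integrable; first exact: segment_compact.
  exact: continuous_subspaceT.
- by move=> h1 h2; split; [exact: h1|rewrite -derive1E].
Qed.

Lemma antiderivative (h : R -> C) (a : R) : (forall x, rcont h x) ->
  exists H : R -> C, forall x, a < x -> rderiv H x (h x).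
Proof.
move=> ch.
have cont (g : R -> R) : (forall y x, `|g y - g x| <= N (h y - h x)) -> continuous g.
  move=> hg x; apply/cvgrPdist_lt => e e0; have [d d0 hd] := ch x _ e0.
  apply/nbhs_ballP; exists d => //= y; rewrite /ball /= distrC => /hd yd.
  by rewrite distrC (le_lt_trans (hg _ _)).
have [|G hG] := @real_antiderivative (fun x => Re (h x)) a.
  by apply: cont => y x; rewrite -raddfB normc_Re.
have [|K hK] := @real_antiderivative (fun x => Im (h x)) a.
  by apply: cont => y x; rewrite -raddfB normc_Im.
exists (fun x => rc (G x) + 'i%C * rc (K x)) => x ax.
by rewrite [h x]complexE; apply: rderiv_cart; [exact: hG|exact: hK].
Qed.

End Derivatives.

(** * Goursat's lemma *)

Section Rectangles.
Variable R : realType.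
Local Notation C := R[i].
Local Notation N := (@normc R).
Local Notation rc := (real_complex R).

Definition pt (x y : R) : C := rc x + 'i%C * rc y.

Lemma ptE (z : C) : z = pt (Re z) (Im z).
Proof. exact: complexE. Qed.

Lemma Re_pt x y : Re (pt x y) = x.
Proof. by rewrite /pt; simpc => /=; ring. Qed.

Lemma Im_pt x y : Im (pt x y) = y.
Proof. by rewrite /pt; simpc => /=; ring. Qed.

Lemma ptB x y u v : pt x y - pt u v = pt (x - u) (y - v).
Proof. by rewrite /pt !rmorphB; ring. Qed.

Lemma normc_pt x y : N (pt x y) <= `|x| + `|y|.
Proof.
by rewrite (le_trans (le_normcD _ _))// normcM normc_i mul1r !normc_rc.
Qed.

(** Along a line an affine function has a quadratic antiderivative; these are subtracted in the
    estimate over a rectangle. *)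
Lemma rderiv_quad (al be : C) x :
  rderiv (fun y => al * rc y + be * rc y ^+ 2) x (al + 2 * be * rc x).
Proof.
move=> e e0; have b0 : 0 < N be + 1 by rewrite ltr_wpDl ?normc_ge0.
exists (e / (N be + 1)); first by rewrite divr_gt0.
move=> y; rewrite ltr_pdivlMr// => yd.
have -> : al * rc y + be * rc y ^+ 2 - (al * rc x + be * rc x ^+ 2) -
  rc (y - x) * (al + 2 * be * rc x) = rc (y - x) * rc (y - x) * be.
  by rewrite !rmorphB; ring.
rewrite !normcM normc_rc mulrAC ler_wpM2r// (le_trans _ (ltW yd))//.
by rewrite ler_wpM2l// lerDl.
Qed.

(** [PH y] and [PV x] are antiderivatives along horizontal and vertical lines;
    the fundamental theorem of calculus gives them to the right of a base point
    [lo] only. *)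
Definition side_primitives (f : C -> C) lo (PH PV : R -> R -> C) :=
  (forall y x, lo < x -> rderiv (PH y) x (f (pt x y))) /\
  (forall x y, lo < y -> rderiv (PV x) y (f (pt x y))).

(** The integral of [f] along the boundary: with side integrals written as
    differences of antiderivatives, its additivity is a ring identity. *)
Definition rect_int (PH PV : R -> R -> C) x0 x1 y0 y1 : C :=
  (PH y0 x1 - PH y0 x0) + 'i%C * (PV x1 y1 - PV x1 y0)
  - (PH y1 x1 - PH y1 x0) - 'i%C * (PV x0 y1 - PV x0 y0).

Lemma ex_side_primitives f lo : (forall p, ccont f p) ->
  exists PH PV, side_primitives f lo PH PV.
Proof.
move=> cf.
have hH y : exists H, forall x, lo < x -> rderiv H x (f (pt x y)).
  apply: antiderivative => x e e0; have [d d0 hd] := cf (pt x y) _ e0.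
  exists d => // x' xd; apply: hd; rewrite ptB subrr.
  by rewrite (le_lt_trans (normc_pt _ _))// normr0 addr0.
have hV x : exists H, forall y, lo < y -> rderiv H y (f (pt x y)).
  apply: antiderivative => y e e0; have [d d0 hd] := cf (pt x y) _ e0.
  exists d => // y' yd; apply: hd; rewrite ptB subrr.
  by rewrite (le_lt_trans (normc_pt _ _))// normr0 add0r.
exists (fun y => sval (cid (hH y))), (fun x => sval (cid (hV x))).
by split=> [y|x]; [exact: (svalP (cid (hH y)))|exact: (svalP (cid (hV x)))].
Qed.

Section Fixed.
Variables (f : C -> C) (lo : R) (PH PV : R -> R -> C).
Hypothesis prims : side_primitives f lo PH PV.
Local Notation I := (rect_int PH PV).

Lemma btw_gt (a b c : R) : lo < a -> lo < b -> btw a b c -> lo < c.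
Proof. by move=> ? ? [] /andP[? ?]; lra. Qed.

(** Subtracting the affine function does not change the integral. *)
Lemma rect_int_bound al be M x0 x1 y0 y1 :
  lo < x0 -> lo < x1 -> lo < y0 -> lo < y1 ->
  (forall x y, btw x0 x1 x -> btw y0 y1 y ->
     N (f (pt x y) - (al + be * pt x y)) <= M) ->
  N (I x0 x1 y0 y1) <= 2 * M * (`|x1 - x0| + `|y1 - y0|).
Proof.
move=> hx0 hx1 hy0 hy1 hM; have [pH pV] := prims.
(* Antiderivatives of [al + be * pt x y] along horizontal and vertical lines; their contributions to
   the boundary integral cancel identically. *)
pose AH y x := (al + be * 'i%C * rc y) * rc x + be / 2 * rc x ^+ 2.
pose AV x y := (al + be * rc x) * rc y + be * 'i%C / 2 * rc y ^+ 2.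
have hH y : btw y0 y1 y ->
    N ((PH y x1 - AH y x1) - (PH y x0 - AH y x0)) <= M * `|x1 - x0|.
  move=> hy; apply: (@rderiv_bound _ (fun x => PH y x - AH y x)
    (fun x => f (pt x y) - (al + be * pt x y))) => x hx.
  split; last exact: hM.
  apply: rderivB; first by apply: pH; exact: btw_gt hx.
  rewrite (_ : al + be * pt x y =
    al + be * 'i%C * rc y + 2 * (be / 2) * rc x); first exact: rderiv_quad.
  by rewrite /pt; field.
have hV x : btw x0 x1 x ->
    N ((PV x y1 - AV x y1) - (PV x y0 - AV x y0)) <= M * `|y1 - y0|.
  move=> hx; apply: (@rderiv_bound _ (fun y => PV x y - AV x y)
    (fun y => f (pt x y) - (al + be * pt x y))) => y hy.
  split; last exact: hM.
  apply: rderivB; first by apply: pV; exact: btw_gt hy.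
  rewrite (_ : al + be * pt x y =
    al + be * rc x + 2 * (be * 'i%C / 2) * rc y); first exact: rderiv_quad.
  by rewrite /pt; field.
have -> : I x0 x1 y0 y1 =
    ((PH y0 x1 - AH y0 x1) - (PH y0 x0 - AH y0 x0))
    + 'i%C * ((PV x1 y1 - AV x1 y1) - (PV x1 y0 - AV x1 y0))
    - ((PH y1 x1 - AH y1 x1) - (PH y1 x0 - AH y1 x0))
    - 'i%C * ((PV x0 y1 - AV x0 y1) - (PV x0 y0 - AV x0 y0)).
  by rewrite /rect_int /AH /AV; field.
have h1 := hH _ (btwxx y0 y1); have h2 := hH _ (btwyy y0 y1).
have h3 := hV _ (btwxx x0 x1); have h4 := hV _ (btwyy x0 x1).
rewrite (le_trans (normcB _ _))// normcM normc_i mul1r.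
rewrite (le_trans (lerD (normcB _ _) h3))//.
rewrite (le_trans (lerD (lerD (le_normcD _ _) h2) (lexx _)))//.
by rewrite normcM normc_i mul1r; lra.
Qed.

Lemma le_any_eq0 (z : C) (S : R) : 0 <= S ->
  (forall e, 0 < e -> N z <= e * S) -> z = 0.
Proof.
move=> S0 h; apply/eqP; rewrite -normc_eq0 eq_le normc_ge0 andbT.
apply/ler_addgt0Pr => e e0; rewrite add0r.
have S1 : 0 < S + 1 by rewrite ltr_wpDl.
rewrite (le_trans (h _ (divr_gt0 e0 S1)))// mulrAC -mulrA ler_piMr ?(ltW e0)//.
by rewrite ler_pdivrMr// mul1r lerDl.
Qed.

(** The bound [e * S ^+ 2], with [S] the sum of the side lengths, is compatible with quartering,
    since [4 * (S / 2) ^+ 2 = S ^+ 2]. Near a point of differentiability the affine approximation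
    errs by at most [e / 2 * S] along a perimeter [2 * S], which gives this bound locally. *)
Lemma goursat x0 x1 y0 y1 :
  lo < x0 -> lo < x1 -> lo < y0 -> lo < y1 ->
  (forall x y, btw x0 x1 x -> btw y0 y1 y -> exists l, cderiv f (pt x y) l) ->
  I x0 x1 y0 y1 = 0.
Proof.
move=> hx0 hx1 hy0 hy1 hol.
apply: (@le_any_eq0 _ ((`|x1 - x0| + `|y1 - y0|) ^+ 2)); first exact: sqr_ge0.
move=> e e0.
apply: (@bisect2 _ (fun u0 u1 v0 v1 =>
  N (I u0 u1 v0 v1) <= e * (`|u1 - u0| + `|v1 - v0|) ^+ 2)).
  move=> u0 u1 v0 v1 um vm; move: (btw_dist (btw_half u0 u1)) (btw_dist (btw_half v0 v1)).
  rewrite -/um -/vm.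
  have -> : `|u1 - um| = `|um - u0|.
    by rewrite (_ : u1 - um = um - u0)// /um; field.
  have -> : `|v1 - vm| = `|vm - v0|.
    by rewrite (_ : v1 - vm = vm - v0)// /vm; field.
  move=> -> -> h1 h2 h3 h4.
  have -> : I u0 u1 v0 v1 =
    I u0 um v0 vm + I um u1 v0 vm + I u0 um vm v1 + I um u1 vm v1.
    by rewrite /rect_int; ring.
  rewrite (le_trans (le_normcD _ _))// (le_trans (lerD (le_normcD _ _) h4))//.
  rewrite (le_trans (lerD (lerD (le_normcD _ _) h3) (lexx _)))//.
  by rewrite (le_trans (lerD (lerD (lerD h1 h2) (lexx _)) (lexx _)))//; lra.
move=> cx cy hcx hcy; have [l hl] := hol _ _ hcx hcy.
have e20 : 0 < e / 2 by rewrite divr_gt0.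
have [d d0 hd] := hl _ e20; exists (d / 2); first by rewrite divr_gt0.
move=> u0 u1 v0 v1 hu0 hu1 hv0 hv1 huc hvc du dv.
set S := `|u1 - u0| + `|v1 - v0|.
have -> : e * S ^+ 2 = 2 * (e / 2 * S) * S by field.
apply: (@rect_int_bound (f (pt cx cy) - l * pt cx cy) l).
- exact: btw_gt hu0.
- exact: btw_gt hu1.
- exact: btw_gt hv0.
- exact: btw_gt hv1.
move=> x y hx hy.
have -> : f (pt x y) - (f (pt cx cy) - l * pt cx cy + l * pt x y) =
  f (pt x y) - f (pt cx cy) - l * (pt x y - pt cx cy) by ring.
have dist a b c c' : btw a b c -> btw a b c' -> `|c' - c| <= `|b - a|.
  by rewrite /btw => -[] /andP[? ?] [] /andP[? ?]; rewrite !ler_norml;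
     case: (ler0P (b - a)) => ?; lra.
have zS : N (pt x y - pt cx cy) <= S.
  by rewrite ptB (le_trans (normc_pt _ _))// lerD// dist.
rewrite (le_trans (hd _ _))//; last by rewrite ler_wpM2l ?(ltW e20).
by rewrite (le_lt_trans zS)// /S; lra.
Qed.

(** Cut off a small rectangle at the exceptional corner; the other three pieces
    contribute [0] and the small one tends to [0] by continuity. *)
Lemma goursat_corner x0 x1 y0 y1 :
  lo < x0 -> lo < x1 -> lo < y0 -> lo < y1 -> ccont f (pt x0 y0) ->
  (forall x y, btw x0 x1 x -> btw y0 y1 y -> pt x y != pt x0 y0 ->
     exists l, cderiv f (pt x y) l) ->
  I x0 x1 y0 y1 = 0.
Proof.
move=> hx0 hx1 hy0 hy1 cf hol.
have [->|xx] := eqVneq x1 x0; first by rewrite /rect_int; ring.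
have [->|yy] := eqVneq y1 y0; first by rewrite /rect_int; ring.
set S := `|x1 - x0| + `|y1 - y0|.
have S0 : 0 < S by rewrite ltr_pwDl ?normr_gt0 ?subr_eq0.
apply: (@le_any_eq0 _ (2 * S)); first by rewrite mulr_ge0 ?(ltW S0).
move=> e e0; have [d d0 hd] := cf 1 ltr01.
(* The first bound gives [t < 1], the second turns the final estimate into [e * (2 * S)], the third
   keeps the small rectangle where [f] differs from its corner value by less than [1]. *)
pose t := Num.min (1 / 2) (Num.min e (d / (2 * S))).
have [t0 t1 te td] : [/\ 0 < t, t < 1, t <= e & t * S < d].
  rewrite /t !lt_min divr_gt0// e0 divr_gt0 ?mulr_gt0//; split=> //.
  - by rewrite gt_min; apply/orP; left; lra.
  - by rewrite !ge_min lexx orbT.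
  - rewrite -ltr_pdivlMr// !gt_min; apply/orP; right; apply/orP; right.
    by rewrite ltr_pM2l// ltf_pV2 ?posrE ?mulr_gt0//; lra.
pose xm := x0 + t * (x1 - x0); pose ym := y0 + t * (y1 - y0).
have mid (a b : R) : btw a b (a + t * (b - a)).
  have s0 : 0 < 1 - t by rewrite subr_gt0.
  rewrite /btw; case: (leP a b) => [|/ltW] h; [left|right].
    have := mulr_ge0 (ltW t0) (_ : 0 <= b - a); have := mulr_ge0 (ltW s0) (_ : 0 <= b - a).
    by rewrite subr_ge0 h mulrBl mul1r => /(_ isT) h1 /(_ isT) h2; apply/andP; split; lra.
  have := mulr_ge0 (ltW t0) (_ : 0 <= a - b); have := mulr_ge0 (ltW s0) (_ : 0 <= a - b).
  by rewrite subr_ge0 h mulrBl mul1r => /(_ isT) h1 /(_ isT) h2; apply/andP; split; lra.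
have not_end (a b c : R) : b != a -> btw (a + t * (b - a)) b c -> c != a.
  move=> ba hc; apply/eqP => E; move: hc ba; rewrite {}E.
  rewrite neq_lt => hc /orP[] ba.
    by have := mulr_gt0 t0 (_ : 0 < a - b); rewrite subr_gt0 => /(_ ba);
       case: hc => /andP[? ?]; lra.
  by have := mulr_gt0 t0 (_ : 0 < b - a); rewrite subr_gt0 => /(_ ba);
     case: hc => /andP[? ?]; lra.
have neq_x x y : x != x0 -> pt x y != pt x0 y0.
  by apply: contra_neq => /(congr1 (@complex.Re R)); rewrite !Re_pt.
have neq_y x y : y != y0 -> pt x y != pt x0 y0.
  by apply: contra_neq => /(congr1 (@complex.Im R)); rewrite !Im_pt.
have hxm := mid x0 x1; have hym := mid y0 y1.
have lxm : lo < xm by exact: btw_gt hxm.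
have lym : lo < ym by exact: btw_gt hym.
have xS := btwxx x0 x1; have xE := btwyy x0 x1.
have yS := btwxx y0 y1; have yE := btwyy y0 y1.
have -> : I x0 x1 y0 y1 =
  I x0 xm y0 ym + I xm x1 y0 ym + I x0 xm ym y1 + I xm x1 ym y1.
  by rewrite /rect_int; ring.
rewrite (@goursat xm x1 y0 ym)//; last first.
  move=> x y hx hy; apply: hol.
  - exact: btw_trans hxm xE hx.
  - exact: btw_trans yS hym hy.
  - by apply: neq_x; exact: not_end xx hx.
rewrite (@goursat x0 xm ym y1)//; last first.
  move=> x y hx hy; apply: hol.
  - exact: btw_trans xS hxm hx.
  - exact: btw_trans hym yE hy.
  - by apply: neq_y; exact: not_end yy hy.
rewrite (@goursat xm x1 ym y1)//; last first.
  move=> x y hx hy; apply: hol.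
  - exact: btw_trans hxm xE hx.
  - exact: btw_trans hym yE hy.
  - by apply: neq_x; exact: not_end xx hx.
rewrite !addr0.
have sz : `|xm - x0| + `|ym - y0| = t * S.
  rewrite /xm /ym !(addrC _ (_ * _)) !addrK !normrM (ger0_norm (ltW t0)).
  by rewrite -mulrDr.
apply: le_trans (_ : 2 * 1 * (t * S) <= _); last first.
  by rewrite mulr1 mulrCA ler_wpM2r// mulr_ge0// ltW.
rewrite -sz; apply: (@rect_int_bound (f (pt x0 y0)) 0) => // x y hx hy.
rewrite mul0r addr0 ltW// hd// ptB (le_lt_trans (normc_pt _ _))//.
rewrite (le_lt_trans _ td)// -sz (btw_dist hx) (btw_dist hy).
have := normr_ge0 (xm - x); have := normr_ge0 (ym - y); lra.
Qed.

(** If [p] lies in the rectangle, then it is a common corner of four rectangles; with oriented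
    endpoints each of them can be listed from [p], at the price of signs. *)
Lemma goursat_except p x0 x1 y0 y1 :
  lo < x0 -> lo < x1 -> lo < y0 -> lo < y1 -> ccont f p ->
  (forall x y, btw x0 x1 x -> btw y0 y1 y -> pt x y != p ->
     exists l, cderiv f (pt x y) l) ->
  I x0 x1 y0 y1 = 0.
Proof.
move=> hx0 hx1 hy0 hy1; rewrite (ptE p); set px := Re p; set py := Im p => cf hol.
have [[hpx hpy]|out] := pselect (btw x0 x1 px /\ btw y0 y1 py); last first.
  apply: goursat => // x y hx hy; apply: hol => //.
  apply/negP => /eqP E; apply: out; move: hx hy.
  have <- : x = px by rewrite -(Re_pt x y) E Re_pt.
  have <- : y = py by rewrite -(Im_pt x y) E Im_pt.
  by [].

have lpx : lo < px by exact: btw_gt hpx.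
have lpy : lo < py by exact: btw_gt hpy.
have xS := btwxx x0 x1; have xE := btwyy x0 x1.
have yS := btwxx y0 y1; have yE := btwyy y0 y1.
have -> : I x0 x1 y0 y1 =
  I px x1 py y1 - I px x0 py y1 - I px x1 py y0 + I px x0 py y0.
  by rewrite /rect_int; ring.
rewrite !goursat_corner ?subrr ?addr0//.
- by move=> x y hx hy; apply: hol; [exact: btw_trans hpx xS hx|exact: btw_trans hpy yS hy].
- by move=> x y hx hy; apply: hol; [exact: btw_trans hpx xE hx|exact: btw_trans hpy yS hy].
- by move=> x y hx hy; apply: hol; [exact: btw_trans hpx xS hx|exact: btw_trans hpy yE hy].
- by move=> x y hx hy; apply: hol; [exact: btw_trans hpx xE hx|exact: btw_trans hpy yE hy].
Qed.

End Fixed.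
End Rectangles.

(** * ** * Comparison with limits over the complex scalars *)

Section Bridge.
Variable R : realType.
Local Notation C := R[i].
Local Notation N := (@normc R).
Local Notation rc := (real_complex R).

Lemma norm_normc (z : C) : `|z| = rc (N z).
Proof. by []. Qed.

Lemma scaleCE (a b : C) : a *: b = a * b.
Proof. by []. Qed.

Lemma gt0_rc (e : C) : 0 < e -> exists2 e', 0 < e' & e = rc e'.
Proof.
move=> e0; exists (Re e); last by rewrite RRe_real// gtr0_real.
by move: e0; rewrite ltcE => /andP[_].
Qed.

Lemma ccontP (f : C -> C) p : ccont f p <-> {for p, continuous f}.
Proof.
split=> cf.
  apply/(@cvgrPdist_lt _ _ _ _ (nbhs_filter p)) => e /gt0_rc[e' e0 ->].
  have [d d0 hd] := cf _ e0.
  apply/nbhs_ballP; exists (rc d); first by rewrite /= ltcR.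
  move=> y; rewrite /ball /= !norm_normc !ltcR normcC => /hd.
  by rewrite normcC.
move=> e e0; have /(@cvgrPdist_lt _ _ _ _ (nbhs_filter p)) /(_ (rc e)) := cf.
rewrite ltcR => /(_ e0) /nbhs_ballP[_ /= /gt0_rc[d d0 ->] hd].
exists d => // y yd; rewrite normcC.
by have := hd y; rewrite /ball /= !norm_normc !ltcR; apply; rewrite normcC.
Qed.

Lemma cderivP (f : C -> C) p l : cderiv f p l <-> is_derive p (1 : C) f l.
Proof.
split=> [cf|[df fl] e e0].
  have h : (fun h : C => h^-1 *: ((f \o shift p) (h *: (1 : C)) - f p)) @ 0^' --> l.
    apply/cvgrPdist_le => e /gt0_rc[e' e0 ->]; have [d d0 hd] := cf _ e0.
    rewrite near_withinE; apply/nbhs_ballP; exists (rc d); first by rewrite /= ltcR.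
    move=> y; rewrite /ball /= sub0r normrN norm_normc ltcR => yd y0.
    rewrite norm_normc lecR [y *: _]mulr1.
    have := hd (p + y); rewrite addrAC subrr add0r => /(_ yd) h.
    have -> : l - y^-1 *: (f (y + p) - f p) = - (y^-1 * (f (p + y) - f p - l * y)).
      by rewrite [y + p]addrC scaleCE; field.
    rewrite normcN normcM normcV mulrC ler_pdivrMr ?normc_gt0//.
  by apply: DeriveDef; [apply/cvg_ex; exists l|exact: cvg_lim h].
have : (fun h : C => h^-1 *: ((f \o shift p) (h *: (1 : C)) - f p)) @ 0^' --> l.
  by rewrite -fl; exact: df.
move=> /cvgrPdist_le /(_ (rc e)); rewrite ltcR => /(_ e0); rewrite near_withinE.
move=> /nbhs_ballP[_ /= /gt0_rc[d d0 ->] hd]; exists d => // y yd.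
have [->|yp] := eqVneq y p; first by rewrite !subrr mulr0 subr0 normc0 mulr0.
have yp0 : y - p != 0 by rewrite subr_eq0.
have := hd (y - p); rewrite /ball /= sub0r normrN !norm_normc ltcR => /(_ yd yp0).
rewrite lecR [_ *: 1]mulr1 subrK => h.
have -> : f y - f p - l * (y - p) =
    - ((l - (y - p)^-1 *: (f y - f p)) * (y - p)).
  by rewrite scaleCE; field.
by rewrite normcN normcM ler_wpM2r ?normc_ge0.
Qed.

Lemma cderiv_ccont (f : C -> C) p l : cderiv f p l -> ccont f p.
Proof.
move=> /cderivP[df _]; apply/ccontP; apply: differentiable_continuous.
exact/derivable1_diffP.
Qed.

End Bridge.

(** * ** * Holomorphic functions and primitives on a disc *)

Section Holomorphic.
Variable R : realType.
Local Notation C := R[i].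
Local Notation N := (@normc R).
Local Notation rc := (real_complex R).
Implicit Types (f g : C -> C) (p z : C).

Definition hol f p := exists l, cderiv f p l.

Lemma holP f p : hol f p <-> derivable f p 1.
Proof.
split=> [[l /cderivP[]//]|df]; exists ('D_1 f p).
by apply/cderivP/derivableP.
Qed.

Lemma hol_ccont f p : hol f p -> ccont f p.
Proof. by case=> l /cderiv_ccont. Qed.

Lemma hol_cst a p : hol (fun=> a) p.
Proof. exact/holP/derivable_cst. Qed.

Lemma hol_id p : hol id p.
Proof. exact/holP/derivable_id. Qed.

Lemma holB f g p : hol f p -> hol g p -> hol (fun z => f z - g z) p.
Proof. by move=> /holP hf /holP hg; apply/holP; exact (derivableB hf hg). Qed.

Lemma holM f g p : hol f p -> hol g p -> hol (fun z => f z * g z) p.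
Proof. by move=> /holP hf /holP hg; apply/holP; exact (derivableM hf hg). Qed.

Lemma holV f p : f p != 0 -> hol f p -> hol (fun z => (f z)^-1) p.
Proof. by move=> f0 /holP hf; apply/holP; exact (derivableV f0 hf). Qed.

Lemma ccontM f g p : ccont f p -> ccont g p -> ccont (fun z => f z * g z) p.
Proof. by move=> /ccontP hf /ccontP hg; apply/ccontP; exact (continuousM hf hg). Qed.

Lemma ccontX f n p : ccont f p -> ccont (fun z => f z ^+ n) p.
Proof.
move=> hf; elim: n => [|n IH]; first exact: hol_ccont (hol_cst _ _).
by under eq_fun do rewrite exprS; exact: ccontM.
Qed.

Lemma ccontB f g p : ccont f p -> ccont g p -> ccont (fun z => f z - g z) p.
Proof. by move=> /ccontP hf /ccontP hg; apply/ccontP; exact (continuousB hf hg). Qed.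

Lemma ccontV f p : f p != 0 -> ccont f p -> ccont (fun z => (f z)^-1) p.
Proof. by move=> f0 /ccontP hf; apply/ccontP; exact (continuousV f0 hf). Qed.

Lemma normc_conj z : N (conjc z) = N z.
Proof. by apply: complexI; rewrite -!norm_normc normcJ. Qed.

Lemma ccont_conj f p : ccont f p -> ccont (fun z => conjc (f z)) p.
Proof.
by move=> hf e /hf[d d0 hd]; exists d => // z /hd; rewrite -rmorphB normc_conj.
Qed.

Lemma ccont_comp f g p : ccont f p -> ccont g (f p) -> ccont (fun z => g (f z)) p.
Proof.
by move=> hf hg e /hg[d /hf[d' d'0 hd'] hd]; exists d' => // z /hd' /hd.
Qed.

Lemma hol_near f g p d : 0 < d -> (forall z, N (z - p) < d -> f z = g z) ->
  hol f p -> hol g p.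
Proof.
move=> d0 fg [l hl]; exists l => e /hl[d' d'0 hd'].
exists (Num.min d d'); first exact: min_gt0.
move=> z; rewrite lt_min => /andP[/fg <- /hd']; rewrite -fg//.
by rewrite subrr normc0.
Qed.

Lemma ccont_near f g p d : 0 < d -> (forall z, N (z - p) < d -> f z = g z) ->
  ccont f p -> ccont g p.
Proof.
move=> d0 fg hf e /hf[d' d'0 hd'].
exists (Num.min d d'); first exact: min_gt0.
move=> z; rewrite lt_min => /andP[/fg <- /hd']; rewrite -fg//.
by rewrite subrr normc0.
Qed.

(** The difference quotient with its singularity filled in. It is known to be continuous at [p] but
    not yet holomorphic there, which is why Goursat's lemma allows an exceptional point. *)
Definition quot f p l z := if z == p then l else (f z - f p) / (z - p).

Lemma quot_near f p l z : z != p -> forall y, N (y - z) < N (z - p) ->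
  (f y - f p) / (y - p) = quot f p l y.
Proof.
move=> zp y hy; rewrite /quot ifN//; apply: contraTneq hy => ->.
by rewrite normcC ltxx.
Qed.

Lemma quot_ccont f p l : cderiv f p l -> (forall z, ccont f z) ->
  forall z, ccont (quot f p l) z.
Proof.
move=> fl cf z; have [->|zp] := eqVneq z p.
  move=> e e0; have e20 : 0 < e / 2 by rewrite divr_gt0.
  have [d d0 hd] := fl _ e20; exists d => // y yd.
  rewrite /quot eqxx; have [_|yp] := eqVneq y p; first by rewrite subrr normc0.
  have yp0 : y - p != 0 by rewrite subr_eq0.
  have -> : (f y - f p) / (y - p) - l = (f y - f p - l * (y - p)) / (y - p).
    by field.
  rewrite normcM normcV ltr_pdivrMr ?normc_gt0//.
  rewrite (le_lt_trans (hd _ yd))// ltr_pM2r ?normc_gt0//; lra.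
have zp0 : 0 < N (z - p) by rewrite normc_gt0 subr_eq0.
apply: (ccont_near zp0 (quot_near f l zp)); apply: ccontM.
  by apply: ccontB => //; exact: hol_ccont (hol_cst _ _).
apply: ccontV; first by rewrite subr_eq0.
exact: hol_ccont (holB (hol_id _) (hol_cst _ _)).
Qed.

Lemma quot_hol f p l z : z != p -> hol f z -> hol (quot f p l) z.
Proof.
move=> zp fz; have zp0 : 0 < N (z - p) by rewrite normc_gt0 subr_eq0.
apply: (hol_near zp0 (quot_near f l zp)); apply: holM.
  by apply: holB => //; exact: hol_cst.
by apply: holV; [rewrite subr_eq0|exact: holB (hol_id _) (hol_cst _ _)].
Qed.

Lemma pt_mono x y y' : `|y| <= `|y'| -> N (pt x y) <= N (pt x y').
Proof.
move=> yy; have E z : N z = Num.sqrt (Re z ^+ 2 + Im z ^+ 2) by case: z.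
rewrite !E !Re_pt !Im_pt ler_wsqrtr// lerD2l.
by rewrite -(real_normK (num_real y)) -(real_normK (num_real y')) ler_sqr ?nnegrE.
Qed.

Lemma rderiv_lin (a : C) x : rderiv (fun t => a * rc t) x a.
Proof.
have := rderiv_quad a 0 x; rewrite mulr0 mul0r addr0.
by under eq_fun do rewrite mul0r addr0.
Qed.

(** [F z] integrates [f] along the real axis to [Re z] and then vertically to [z]. A vanishing
    rectangle integral replaces the path between [z0] and [z] by one that stays near [z0], where [f]
    is close to [f z0]. Continuity is assumed on the whole plane because the side primitives are
    built from it; [clamp] later arranges this. *)
Lemma disc_primitive f rho p : 0 < rho -> (forall z, ccont f z) ->
  (forall z, N z < rho -> z != p -> hol f z) ->
  exists F, forall z, N z < rho -> cderiv F z (f z).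
Proof.
move=> rho0 cf hf; have [PH [PV prims]] := ex_side_primitives (- rho) cf.
have [pH pV] := prims.
have inlo z : N z < rho -> - rho < Re z /\ - rho < Im z.
  move=> zr; have := normc_Re z; have := normc_Im z.
  by rewrite !ler_norml => /andP[? ?] /andP[? ?]; split; lra.
pose F z := (PH 0 (Re z) - PH 0 0) + 'i%C * (PV (Re z) (Im z) - PV (Re z) 0).
exists F => z0 z0r e e0; have e20 : 0 < e / 2 by rewrite divr_gt0.
have [d d0 hd] := cf z0 _ e20.
exists (Num.min (d / 2) (rho - N z0)); first by rewrite min_gt0 ?divr_gt0 ?subr_gt0.
move=> z; rewrite lt_min => /andP[zd zr].
have zr' : N z < rho.
  rewrite -(subrK z0 z) (le_lt_trans (le_normcD _ _))//; lra.
have [lx0 ly0] := inlo _ z0r; have [lx ly] := inlo _ zr'.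
have ez t u : pt t u - z0 = pt (t - Re z0) (u - Im z0).
  by rewrite {1}(ptE z0) ptB.
have eB : z - z0 = pt (Re z - Re z0) (Im z - Im z0) by rewrite -ez -ptE.
have hRe : `|Re z - Re z0| <= N (z - z0).
  by rewrite -[Re z - _](Re_pt _ (Im z - Im z0)) -eB normc_Re.
have hIm : `|Im z - Im z0| <= N (z - z0).
  by rewrite -[Im z - _](Im_pt (Re z - Re z0)) -eB normc_Im.
move: zd zr lx0 ly0 lx ly hRe hIm ez eB.
rewrite /F.
set x := Re z; set y := Im z; set x0 := Re z0; set y0 := Im z0.
move=> zd zr lx0 ly0 lx ly hRe hIm ez eB.
(* The rectangle lies in the disc: its points are no farther from [0] than those of the side at
   height [y0], and these are within [N (z - z0)] of [z0]. *)
have I0 : rect_int PH PV x0 x 0 y0 = 0.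
  apply: (@goursat_except _ f (- rho) PH PV prims p) => //; first by lra.
  move=> t s ht hs tp; apply: hf => //.
  rewrite (le_lt_trans (@pt_mono _ _ y0 _))//.
    by move: hs; rewrite /btw => -[] /andP[h1 h2];
       [rewrite !ger0_norm//; lra|rewrite !ler0_norm//; lra].
  rewrite -(subrK z0 (pt t y0)) (le_lt_trans (le_normcD _ _))//.
  rewrite ez subrr.
  have := normc_pt (t - x0) 0; rewrite normr0 addr0.
  have := btw_dist ht; have := normr_ge0 (x - t); lra.
have hH : N ((PH y0 x - f z0 * rc x) - (PH y0 x0 - f z0 * rc x0)) <= e / 2 * `|x - x0|.
  apply: (@rderiv_bound _ (fun t => PH y0 t - f z0 * rc t) (fun t => f (pt t y0) - f z0)).
  move=> t ht; split.
    by apply: rderivB (rderiv_lin _ _); apply: pH; exact: btw_gt ht.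
  apply/ltW/hd; rewrite ez subrr.
  rewrite (le_lt_trans (normc_pt _ _))// normr0 addr0.
  have := btw_dist ht; have := normr_ge0 (x - t); lra.
have hV : N ((PV x y - f z0 * rc y) - (PV x y0 - f z0 * rc y0)) <= e / 2 * `|y - y0|.
  apply: (@rderiv_bound _ (fun t => PV x t - f z0 * rc t) (fun t => f (pt x t) - f z0)).
  move=> t ht; split.
    by apply: rderivB (rderiv_lin _ _); apply: pV; exact: btw_gt ht.
  apply/ltW/hd; rewrite ez.
  rewrite (le_lt_trans (normc_pt _ _))//.
  have := btw_dist ht; have := normr_ge0 (y - t); lra.
have -> : PH 0 x - PH 0 0 + 'i%C * (PV x y - PV x 0) -
    (PH 0 x0 - PH 0 0 + 'i%C * (PV x0 y0 - PV x0 0)) - f z0 * (z - z0) =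
  rect_int PH PV x0 x 0 y0 + ((PH y0 x - f z0 * rc x) - (PH y0 x0 - f z0 * rc x0))
  + 'i%C * ((PV x y - f z0 * rc y) - (PV x y0 - f z0 * rc y0)).
  by rewrite eB /rect_int /pt !rmorphB; ring.
rewrite I0 add0r (le_trans (le_normcD _ _))// normcM normc_i mul1r.
rewrite (le_trans (lerD hH hV))// -mulrDr -mulrA ler_wpM2l ?(ltW e0)//.
by rewrite mulrC ler_pdivrMr//; lra.
Qed.

End Holomorphic.

(** * Cauchy's formula on circles and power series *)

Section Circle.
Variable R : realType.
Local Notation C := R[i].
Local Notation N := (@normc R).
Local Notation rc := (real_complex R).

Lemma rderiv_comp (f : C -> C) (H : R -> C) x l m :
  rderiv H x m -> cderiv f (H x) l -> rderiv (fun y => f (H y)) x (l * m).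
Proof.
move=> hH hf e e0.
have m0 : 0 < N m + 1 by rewrite ltr_wpDl ?normc_ge0.
have l0 : 0 < N l + 1 by rewrite ltr_wpDl ?normc_ge0.
pose e1 := e / 2 / (N m + 1); have e10 : 0 < e1 by rewrite !divr_gt0.
pose e2 := e / 2 / (N l + 1); have e20 : 0 < e2 by rewrite !divr_gt0.
have [d1 d10 h1] := hf _ e10; have [d2 d20 h2] := hH _ e20.
have [d3 d30 h3] := hH _ ltr01.
exists (Num.min d2 (Num.min d3 (d1 / (N m + 1)))).
  by rewrite !min_gt0// divr_gt0.
move=> y; rewrite !lt_min => /and3P[/h2 y2 /h3 y3].
rewrite ltr_pdivlMr// => y1.
have Hy : N (H y - H x) <= `|y - x| * (N m + 1).
  rewrite -[H y - H x](subrK (rc (y - x) * m)) (le_trans (le_normcD _ _))//.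
  by rewrite normcM normc_rc; lra.
have -> : f (H y) - f (H x) - rc (y - x) * (l * m) =
  (f (H y) - f (H x) - l * (H y - H x)) + l * (H y - H x - rc (y - x) * m).
  by ring.
rewrite (le_trans (le_normcD _ _))// normcM.
have -> : e * `|y - x| = e1 * (`|y - x| * (N m + 1)) + (N l + 1) * (e2 * `|y - x|).
  by rewrite /e1 /e2; field; rewrite !gt_eqF.
rewrite lerD//.
  rewrite (le_trans (h1 _ (le_lt_trans Hy y1)))// ler_wpM2l// ltW//.
by rewrite ler_pM ?normc_ge0// lerDl.
Qed.

Lemma conjcM (a b : C) : conjc (a * b) = conjc a * conjc b.
Proof. exact: rmorphM. Qed.

Lemma conjc_rc (x : R) : conjc (rc x) = rc x.
Proof. exact: conjc_real. Qed.

Lemma rderiv_conj (H : R -> C) x l :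
  rderiv H x l -> rderiv (fun y => conjc (H y)) x (conjc l).
Proof.
move=> hH e /hH[d d0 hd]; exists d => // y /hd.
have -> : conjc (H y) - conjc (H x) - rc (y - x) * conjc l =
  conjc (H y - H x - rc (y - x) * l).
  by rewrite -{1}(conjc_real (y - x)) -!(rmorphM, rmorphB).
by rewrite normc_conj.
Qed.

Lemma rderiv_cst (a : C) x : rderiv (fun=> a) x 0.
Proof.
move=> e e0; exists 1 => // y _.
by rewrite subrr mulr0 subr0 normc0 mulr_ge0// ltW.
Qed.

Lemma rderiv_sum n (H : nat -> R -> C) (h : nat -> C) x :
  (forall k, rderiv (H k) x (h k)) ->
  rderiv (fun y => \sum_(k < n) H k y) x (\sum_(k < n) h k).
Proof.
move=> hH; elim: n => [|n IH].
  by under eq_fun do rewrite big_ord0; rewrite big_ord0; exact: rderiv_cst.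
under eq_fun do rewrite big_ord_recr /=.
by rewrite big_ord_recr /=; exact: rderivD.
Qed.

Lemma rderiv_rcont (H : R -> C) x l : rderiv H x l -> rcont H x.
Proof.
move=> hH e e0; have [d d0 hd] := hH 1 ltr01.
have l0 : 0 < N l + 1 by rewrite ltr_wpDl ?normc_ge0.
exists (Num.min d (e / (N l + 1))); first by rewrite min_gt0// divr_gt0.
move=> y; rewrite lt_min ltr_pdivlMr// => /andP[/hd yd ye].
rewrite (le_lt_trans _ ye)// -[H y - H x](subrK (rc (y - x) * l)).
by rewrite (le_trans (le_normcD _ _))// normcM normc_rc; lra.
Qed.

Lemma rcont_comp (f : C -> C) (H : R -> C) x :
  rcont H x -> ccont f (H x) -> rcont (fun y => f (H y)) x.
Proof.
by move=> hH hf e /hf[d /hH[d' d'0 hd'] hd]; exists d' => // y /hd' /hd.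
Qed.

Lemma rcont_bounded (h : R -> C) a b : (forall x, rcont h x) ->
  exists M, forall x, btw a b x -> N (h x) <= M.
Proof.
move=> ch.
apply: (@bisect2 _ (fun u v _ _ => exists M, forall x, btw u v x -> N (h x) <= M) a b 0 0).
  move=> u v _ _ /= [M1 h1] [M2 h2] _ _; exists (Num.max M1 M2) => x hx.
  rewrite le_max; have [l|l] := leP x ((u + v) / 2).
    by case: hx => /andP[x1 x2]; [rewrite h1//; left|rewrite h2 ?orbT//; right];
       apply/andP; split; lra.
  by case: hx => /andP[x1 x2]; [rewrite h2 ?orbT//; left|rewrite h1//; right];
     apply/andP; split; lra.
move=> c c' hc _; have [d d0 hd] := ch c 1 ltr01; exists d => // u v v0 v1 _ _ _ _.
move=> hcuv _ uvd _; exists (N (h c) + 1) => x hx.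
rewrite -[h x](subrK (h c)) (le_trans (le_normcD _ _))// addrC lerD2l ltW// hd//.
move: uvd; rewrite !ltr_norml; move: hcuv hx.
by rewrite /btw => -[] /andP[? ?] [] /andP[? ?] /andP[? ?]; lra.
Qed.

Definition cis (t : R) : C := pt (cos t) (sin t).

Lemma rderiv_cis t : rderiv cis t ('i%C * cis t).
Proof.
have -> : 'i%C * cis t = rc (- sin t) + 'i%C * rc (cos t).
  rewrite /cis /pt mulrDr mulrA -expr2 sqr_i raddfN; ring.
exact: rderiv_cart (is_derive_cos t) (is_derive_sin t).
Qed.

Lemma normc_cis t : N (cis t) = 1.
Proof.
rewrite /cis; have -> (z : C) : N z = Num.sqrt (Re z ^+ 2 + Im z ^+ 2) by case: z.
by rewrite Re_pt Im_pt cos2Dsin2 sqrtr1.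
Qed.

Lemma cisM_conj t : cis t * conjc (cis t) = 1.
Proof. by rewrite -sqr_normc norm_normc normc_cis expr1n. Qed.

Definition tau : R := pi *+ 2.

Lemma tau_gt0 : 0 < tau.
Proof. by rewrite mulrn_wgt0// pi_gt0. Qed.

Lemma cis_tau : cis tau = cis 0.
Proof. by rewrite /cis cos2pi sin2pi cos0 sin0. Qed.

Definition circ (r t : R) : C := rc r * cis t.

Definition icirc (r t : R) : C := rc r^-1 * conjc (cis t).

Lemma circK r t : r != 0 -> circ r t * icirc r t = 1.
Proof.
by move=> r0; rewrite /circ /icirc mulrACA cisM_conj -rmorphM mulfV// mulr1.
Qed.

Lemma normc_circ r t : 0 <= r -> N (circ r t) = r.
Proof. by move=> r0; rewrite normcM normc_rc normc_cis mulr1 ger0_norm. Qed.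

Lemma normc_icirc r t : 0 <= r -> N (icirc r t) = r^-1.
Proof.
by move=> r0; rewrite normcM normc_rc normc_conj normc_cis mulr1 ger0_norm// invr_ge0.
Qed.

Lemma rderiv_circ r t : rderiv (circ r) t ('i%C * circ r t).
Proof. by rewrite /circ mulrCA; exact/rderivZ/rderiv_cis. Qed.

Lemma rderiv_icirc r t : rderiv (icirc r) t (- 'i%C * icirc r t).
Proof.
have -> : - 'i%C * icirc r t = rc r^-1 * conjc ('i%C * cis t).
  rewrite /icirc conjcM mulrCA; congr (_ * (_ * _)).
  by apply/eqP; rewrite eq_complex /conjc /= oppr0 !eqxx.
exact/rderivZ/rderiv_conj/rderiv_cis.
Qed.

Lemma cderiv_exp n (z : C) : cderiv (fun z => z ^+ n.+1) z (n.+1%:R * z ^+ n).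
Proof.
apply/cderivP; have := @is_deriveX _ _ id n.+1 z 1 1 (is_derive_id z 1).
by rewrite exprfctE [_ *: 1]mulr1.
Qed.

(** On the circle [dw = i w dt], so [q w * w] is the integrand in the angle. Besides [G] it has the
    antiderivative [- i * F], with [F] a primitive on the disc, and this one is periodic. *)
Lemma cauchy_circle (q : C -> C) rho p r (G : R -> C) :
  0 < rho -> 0 <= r -> r < rho -> (forall z, ccont q z) ->
  (forall z, N z < rho -> z != p -> hol q z) ->
  (forall t, btw 0 tau t -> rderiv G t (q (circ r t) * circ r t)) ->
  G tau = G 0.
Proof.
move=> rho0 r0 rr cq hq hG; have [F hF] := disc_primitive rho0 cq hq.
apply/eqP; rewrite -subr_eq0; apply/eqP.
have -> : G tau - G 0 = - 'i%C * F (circ r tau) - (- 'i%C * F (circ r 0)).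
  apply: (@rderiv_unique _ G (fun t => - 'i%C * F (circ r t))
    (fun t => q (circ r t) * circ r t)) => t ht; split; first exact: hG.
  have -> : q (circ r t) * circ r t = - 'i%C * (q (circ r t) * ('i%C * circ r t)).
    transitivity (- 'i%C ^+ 2 * (q (circ r t) * circ r t)); last by ring.
    by rewrite sqr_i opprK mul1r.
  apply/rderivZ/rderiv_comp; first exact: rderiv_circ.
  by apply: hF; rewrite normc_circ.
by rewrite /circ cis_tau subrr.
Qed.

End Circle.

Section PowerSeries.
Variable R : realType.
Local Notation C := R[i].
Local Notation N := (@normc R).
Local Notation rc := (real_complex R).

Definition sums_to (u : nat -> C) (l : C) := forall e, 0 < e ->
  exists n0, forall n, (n0 <= n)%N -> N (\sum_(k < n) u k - l) < e.

Lemma geom_small (M x e : R) : 0 <= x -> x < 1 -> 0 < e ->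
  exists n0, forall n, (n0 <= n)%N -> M * x ^+ n < e.
Proof.
move=> x0 x1 e0.
have : (fun n => M * x ^+ n) @ \oo --> 0.
  by apply: cvg_geometric; rewrite ger0_norm.
move=> /cvgrPdist_lt /(_ _ e0) [n0 _ h]; exists n0 => n /h.
by rewrite /= sub0r normrN => /ltr_normlW.
Qed.

Lemma geom_sum n (x : C) : (\sum_(k < n) x ^+ k) * (1 - x) = 1 - x ^+ n.
Proof.
elim: n => [|n IH]; first by rewrite big_ord0 mul0r expr0 subrr.
by rewrite big_ord_recr /= mulrDl IH exprSr; ring.
Qed.

(** The coefficient [c k] is the mean of [f w * w ^- k] over the circle. Cauchy's theorem for
    [quot f p l], combined with a finite geometric expansion in [p / w], bounds the remainder. The
    second conjunct records that [c] depends on the values on the circle alone. *)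
Lemma cauchy_series (f : C -> C) rho r : 0 < r -> r < rho ->
  (forall z, ccont f z) -> (forall z, N z < rho -> hol f z) ->
  exists c : nat -> C,
    (forall p, N p < r -> sums_to (fun k => c k * p ^+ k) (f p)) /\
    ((forall z, N z = r -> f z = 0) -> forall k, c k = 0).
Proof.
move=> r0 rr cf hf; have rho0 := lt_trans r0 rr; have rN0 := lt0r_neq0 r0.
have T0 := tau_gt0 R; set T := tau R in T0.
(* Antiderivatives exist only strictly to the right of their base point; the base point [-1] makes
   [0] admissible. *)
have Tpos t : btw 0 T t -> -1 < t.
  by case=> /andP[? ?]; lra.
have contE k : exists E : R -> C, forall t, -1 < t ->
    rderiv E t (f (circ r t) * icirc r t ^+ k).
  apply: antiderivative => t.
  (* On the circle the inverse of [w] equals [conj w / r ^ 2], which is continuous on the whole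
     plane. *)
  have -> : (fun t => f (circ r t) * icirc r t ^+ k) =
    (fun t => (fun z => f z * (rc r^-1 * rc r^-1 * conjc z) ^+ k) (circ r t)).
    apply/funext => u; congr (_ * _ ^+ k).
    rewrite /icirc /circ conjcM conjc_rc.
    by rewrite -!mulrA; congr (_ * _); rewrite mulrA -rmorphM mulVf// mul1r.
  apply: (@rcont_comp _ (fun z => f z * (rc r^-1 * rc r^-1 * conjc z) ^+ k) (circ r)); first exact: rderiv_rcont (rderiv_circ _ _).
  apply: ccontM => //; apply: ccontX; apply: ccontM.
    exact: hol_ccont (hol_cst _ _).
  exact: (@ccont_conj _ id _ (hol_ccont (hol_id _))).
pose E k := sval (cid (contE k)).
have hE k t : -1 < t -> rderiv (E k) t (f (circ r t) * icirc r t ^+ k).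
  exact: (svalP (cid (contE k))).
pose c k := (E k T - E k 0) / rc T.
have rcT0 : rc T != 0 by rewrite -normc_eq0 normc_rc normr_eq0 lt0r_neq0.
have Tc k : rc T * c k = E k T - E k 0 by rewrite mulrC mulfVK.
exists c; split; last first.
  move=> f0 k; rewrite /c; have -> : E k T - E k 0 = 0 - 0.
    apply: (@rderiv_unique _ _ (fun=> 0) (fun=> 0)) => t /Tpos ht; split.
      by have := hE k t ht; rewrite f0 ?mul0r// normc_circ// ltW.
    exact: rderiv_cst.
  by rewrite subrr mul0r.
move=> p pr; have [l hl] := hf p (lt_trans pr rr).
pose q := quot f p l.
have cq z : ccont q z by exact: quot_ccont.
have hq z : N z < rho -> z != p -> hol q z by move=> /hf zr zp; exact: quot_hol.
have ccir t : rcont (fun t => q (circ r t) * circ r t) t.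
  apply: (@rcont_comp _ (fun z => q z * z) (circ r)).
    exact: rderiv_rcont (rderiv_circ _ _).
  by apply: ccontM => //; exact: hol_ccont (hol_id _).
have [Q hQ] := antiderivative (-1) ccir.
have QT : Q T = Q 0.
  apply: (cauchy_circle rho0 (ltW r0) rr cq hq) => t /Tpos ht; exact: hQ.
have [M hM] := rcont_bounded 0 T ccir.
(* An antiderivative of [w ^- k] in the angle. It is periodic for [k > 0], so only [k = 0]
   contributes over a full turn, and this term produces [f p]. *)
pose D k (t : R) : C := if k is k'.+1 then 'i%C / k'.+1%:R * icirc r t ^+ k'.+1 else rc t.
have hD k t : rderiv (D k) t (icirc r t ^+ k).
  case: k => [|k] /=.
    by have := rderiv_lin 1 t; under eq_fun do rewrite mul1r.
  have -> : icirc r t ^+ k.+1 = 'i%C / k.+1%:R *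
    (k.+1%:R * icirc r t ^+ k * (- 'i%C * icirc r t)).
    transitivity (- 'i%C ^+ 2 * icirc r t ^+ k.+1).
      by rewrite sqr_i opprK mul1r.
    have m0 : k.+1%:R != 0 :> C by rewrite pnatr_eq0.
    rewrite (exprS (icirc r t)); move: (icirc r t ^+ k) k.+1%:R m0 => X m m0.
    by field.
  exact: rderivZ (rderiv_comp (rderiv_icirc r t) (cderiv_exp k _)).
have DT k : D k T - D k 0 = if k == 0%N then rc T else 0.
  case: k => [|k] /=; first by rewrite (_ : rc 0 = 0) ?subr0.
  by rewrite /icirc cis_tau subrr.
have x1 : N p * r^-1 < 1 by rewrite ltr_pdivrMr// mul1r.
have x0 : 0 <= N p * r^-1 by rewrite mulr_ge0 ?normc_ge0// invr_ge0 ltW.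
have key n : N (\sum_(k < n.+1) c k * p ^+ k - f p) <= M * (N p * r^-1) ^+ n.+1.
  (* [h] is the remainder of the geometric expansion of
     [(f w - f p) * w / (w - p)] in powers of [p / w]. *)
  pose h t := (p * icirc r t) ^+ n.+1 * (q (circ r t) * circ r t).
  pose G t := Q t - \sum_(k < n.+1) p ^+ k * (E k t - f p * D k t).
  have hG t : btw 0 T t -> rderiv G t (h t).
    move=> /Tpos ht.
    have -> : h t = q (circ r t) * circ r t - \sum_(k < n.+1)
        p ^+ k * (f (circ r t) * icirc r t ^+ k - f p * icirc r t ^+ k).
      set g := circ r t; set ig := icirc r t.
      have gig : g * ig = 1 by exact: circK.
      have gp : g != p.
        by apply: contraTneq pr => <-; rewrite normc_circ ?ltxx// ltW.
      have -> : \sum_(k < n.+1) p ^+ k * (f g * ig ^+ k - f p * ig ^+ k) =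
        (q g * g) * ((\sum_(k < n.+1) (p * ig) ^+ k) * (1 - p * ig)).
        rewrite mulrCA mulr_suml; apply: eq_bigr => k _.
        have -> : q g * g * (1 - p * ig) = f g - f p.
          transitivity (q g * (g - p * (g * ig))); first by ring.
          rewrite gig mulr1 /q /quot ifN// -mulrA mulVf ?mulr1// subr_eq0//.
        by rewrite (exprMn k p ig); ring.
      by rewrite geom_sum /h -/g -/ig; ring.
    apply: rderivB; first exact: hQ.
    apply: (@rderiv_sum _ n.+1 (fun k y => p ^+ k * (E k y - f p * D k y))
      (fun k => p ^+ k * (f (circ r t) * icirc r t ^+ k - f p * icirc r t ^+ k))) => k.
    apply: rderivZ; apply: rderivB; first exact: hE.
    exact: (rderivZ (f p) (hD k t)).
  have : N (G T - G 0) <= M * (N p * r^-1) ^+ n.+1 * `|T - 0|.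
    apply: (@rderiv_bound _ G h) => t ht; split; first exact: hG.
    rewrite /h normcM normcX normcM normc_icirc ?(ltW r0)// mulrC.
    by rewrite ler_wpM2r ?exprn_ge0// hM.
  have -> : G T - G 0 = - (rc T * (\sum_(k < n.+1) c k * p ^+ k - f p)).
    transitivity (- \sum_(k < n.+1)
        p ^+ k * ((E k T - E k 0) - f p * (D k T - D k 0))).
      have cancel_Q (x y y' : C) : x - y - (x - y') = y' - y by ring.
      rewrite /G QT cancel_Q -sumrB -sumrN; apply: eq_bigr => k _.
      have term (P e0 e1 v d0 d1 : C) :
        P * (e0 - v * d0) - P * (e1 - v * d1) = - (P * (e1 - e0 - v * (d1 - d0))).
        by ring.
      exact: term.
    congr (- _); rewrite mulrBr mulr_sumr.
    transitivity (\sum_(k < n.+1) rc T * (c k * p ^+ k) -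
      \sum_(k < n.+1) p ^+ k * f p * (D k T - D k 0)).
      rewrite -sumrB; apply: eq_bigr => k _; rewrite mulrA Tc.
      by rewrite mulrBr mulrA [p ^+ k * (E k T - _)]mulrC.
    congr (_ - _); rewrite big_ord_recl DT big1 => [|k _]; last by rewrite DT mulr0.
    by rewrite /= expr0 mul1r addr0 mulrC.
  by rewrite normcN normcM normc_rc subr0 mulrC ler_pM2r// normr_gt0 lt0r_neq0.
move=> e e0; have [n0 hn0] := geom_small M x0 x1 e0.
exists n0.+1 => -[//|n] hn; rewrite (le_lt_trans (key n))// hn0//.
exact: leq_trans hn.
Qed.

End PowerSeries.

(** * ** * Uniqueness of power series and functions of a product *)

Section DiscSeries.
Variable R : realType.
Local Notation C := R[i].
Local Notation N := (@normc R).
Local Notation rc := (real_complex R).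
Implicit Types (u v c : nat -> C).

Lemma sums_toB u v l m : sums_to u l -> sums_to v m ->
  sums_to (fun k => u k - v k) (l - m).
Proof.
move=> hu hv e e0; have e20 : 0 < e / 2 by rewrite divr_gt0.
have [n1 h1] := hu _ e20; have [n2 h2] := hv _ e20.
exists (maxn n1 n2) => n; rewrite geq_max => /andP[/h1 {}h1 /h2 {}h2].
rewrite sumrB; set U := \sum_(k < n) u k; set V := \sum_(k < n) v k.
have -> : U - V - (l - m) = (U - l) - (V - m) by ring.
by rewrite (le_lt_trans (normcB _ _))//; lra.
Qed.

Lemma sums_toZ (a : C) u l : sums_to u l -> sums_to (fun k => a * u k) (a * l).
Proof.
move=> hu e e0; have a0 : 0 < N a + 1 by rewrite ltr_wpDl ?normc_ge0.
have [n0 h] := hu _ (divr_gt0 e0 a0); exists n0 => n /h.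
rewrite ltr_pdivlMr// => {}h; rewrite -mulr_sumr -mulrBr normcM.
rewrite (le_lt_trans _ h)// mulrC ler_wpM2l ?normc_ge0//.
by rewrite lerDl.
Qed.

Lemma sums_to_shift u l : sums_to u l -> sums_to (fun k => u k.+1) (l - u 0%N).
Proof.
move=> h e /h[n0 hn0]; exists n0 => n nn.
have := hn0 n.+1 (leq_trans nn (leqnSn _)); rewrite big_ord_recl.
have -> : \sum_(k < n) u (lift ord0 k) = \sum_(k < n) u k.+1 by exact: eq_bigr.
by rewrite opprB addrCA addrA.
Qed.

Lemma sums_to_unshift u l : sums_to (fun k => u k.+1) l -> sums_to u (u 0%N + l).
Proof.
move=> h e /h[n0 hn0]; exists n0.+1 => -[//|n] nn; have := hn0 n nn.
rewrite big_ord_recl opprD addrACA subrr add0r.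
by have -> : \sum_(k < n) u (lift ord0 k) = \sum_(k < n) u k.+1 by exact: eq_bigr.
Qed.

Lemma sums_to_at0 u : sums_to (fun k => u k * 0 ^+ k) (u 0%N).
Proof.
move=> e e0; exists 1%N => -[//|n] _; rewrite big_ord_recl expr0 mulr1 big1.
  by rewrite addr0 subrr normc0.
by move=> k _; rewrite exprS mul0r mulr0.
Qed.

Lemma sums_to_unique u l m : sums_to u l -> sums_to u m -> l = m.
Proof.
move=> hl hm; apply/eqP; rewrite -subr_eq0; apply/eqP.
apply: (@le_any_eq0 _ _ 2) => // e e0.
have [n1 h1] := hl _ e0; have [n2 h2] := hm _ e0.
have {}h1 := h1 _ (leq_maxl n1 n2); have {}h2 := h2 _ (leq_maxr n1 n2).
by rewrite (le_trans (normc_distD _ (\sum_(k < maxn n1 n2) u k) _))// mulr2n mulrDr mulr1 lerD// ltW// normcC.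
Qed.

Lemma sums_to_bounded u l : sums_to u l -> exists M, forall n, N (u n) <= M.
Proof.
move=> hu; have [n0 h] := hu 1 ltr01.
have S0 : 0 <= \sum_(k < n0) N (u k) by apply: sumr_ge0 => k _; exact: normc_ge0.
exists (2 + \sum_(k < n0) N (u k)) => n; have [nn|nn] := ltnP n n0.
  rewrite (bigD1 (Ordinal nn))//= addrCA ler_wpDr//.
  by rewrite addr_ge0// sumr_ge0// => k _; exact: normc_ge0.
have h1 := h _ nn; have h2 := h _ (leq_trans nn (leqnSn n)).
have -> : u n = (\sum_(k < n.+1) u k - l) - (\sum_(k < n) u k - l).
  by rewrite big_ord_recr /=; ring.
by rewrite (le_trans (normcB _ _))//; lra.
Qed.

Lemma coef_bound c r l : 0 < r -> sums_to (fun k => c k * rc r ^+ k) l ->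
  exists2 M, 0 <= M & forall k, N (c k) <= M * r^-1 ^+ k.
Proof.
move=> r0 /sums_to_bounded[M hM]; exists M.
  exact: le_trans (normc_ge0 _) (hM 0%N).
move=> k; have := hM k; rewrite normcM normcX normc_rc ger0_norm ?(ltW r0)//.
by rewrite exprVn ler_pdivlMr ?exprn_gt0.
Qed.

Lemma geom_sum_le (x : R) n : 0 <= x -> x <= 1 / 2 -> \sum_(k < n) x ^+ k <= 2.
Proof.
move=> x0 x2; elim: n => [|n IH]; first by rewrite big_ord0.
rewrite big_ord_recl expr0 (eq_bigr (fun k : 'I_n => x * x ^+ k)) => [|k _]; last first.
  by rewrite /= /bump /= exprS.
rewrite -mulr_sumr; have := ler_wpM2l x0 IH; lra.
Qed.

(** The bounded terms at [r] give a geometric majorant of ratio [N p / r], at most [1 / 2]. The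
    constant does not depend on [p], so the estimate serves for limits at [0]. *)
Lemma series_lipschitz0 c r l : 0 < r -> sums_to (fun k => c k * rc r ^+ k) l ->
  exists2 K, 0 <= K & forall p (v : C), 2 * N p <= r -> sums_to (fun k => c k * p ^+ k) v ->
    N (v - c 0%N) <= K * N p.
Proof.
move=> r0 /(coef_bound r0)[M M0 hM].
exists (2 * M / r); first by rewrite !mulr_ge0// invr_ge0 ltW.
move=> p v pr hv; apply/ler_addgt0Pr => e e0; have [n0 h] := hv _ e0.
have {}h := h n0.+1 (leqnSn _).
rewrite (le_trans (normc_distD _ (\sum_(k < n0.+1) c k * p ^+ k) _))// addrC.
rewrite lerD//; last by rewrite normcC ltW.
rewrite big_ord_recl expr0 mulr1 addrAC subrr add0r.
rewrite (le_trans (normc_sum _ _))//.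
pose x := N p / r.
have x0 : 0 <= x by rewrite mulr_ge0 ?normc_ge0// invr_ge0 ltW.
have x2 : x <= 1 / 2 by rewrite /x ler_pdivrMr//; lra.
apply: (@le_trans _ _ (\sum_(k < n0) M * x * x ^+ k)).
  apply: ler_sum => k _; rewrite /= /bump /= normcM normcX.
  have -> : M * x * x ^+ k = M * r^-1 ^+ k.+1 * N p ^+ k.+1.
    by rewrite -mulrA -exprS /x exprMn -mulrA [N p ^+ _ * _]mulrC.
  by rewrite add1n ler_wpM2r ?exprn_ge0 ?normc_ge0.
rewrite -mulr_sumr (le_trans (ler_wpM2l _ (geom_sum_le n0 x0 x2)))//.
  by rewrite mulr_ge0.
by rewrite /x; lra.
Qed.

(** Only nonzero [p] are assumed, so that the hypothesis survives division by [p] and passes to the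
    shifted series. *)
Lemma series_zero c r : 0 < r ->
  (forall p, 0 < N p -> N p < r -> sums_to (fun k => c k * p ^+ k) 0) ->
  forall k, c k = 0.
Proof.
move=> r0 + k.
have head c' : (forall p, 0 < N p -> N p < r -> sums_to (fun k => c' k * p ^+ k) 0) ->
    c' 0%N = 0.
  move=> hc; have r20 : 0 < r / 2 by rewrite divr_gt0.
  have hr : sums_to (fun k => c' k * rc (r / 2) ^+ k) 0.
    by apply: hc; rewrite normc_rc ger0_norm ?(ltW r20)//; lra.
  have [K K0 hK] := series_lipschitz0 r20 hr.
  apply: (le_any_eq0 K0) => e e0.
  pose t := Num.min e (r / 4).
  have t0 : 0 < t by rewrite min_gt0// divr_gt0.
  have te : t <= e by rewrite ge_min lexx.
  have tr : t <= r / 4 by rewrite ge_min lexx orbT.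
  have := hK (rc t) 0; rewrite normc_rc (ger0_norm (ltW t0)) sub0r normcN => h.
  have t2 : 2 * t <= r / 2 by lra.
  have ht : sums_to (fun k => c' k * rc t ^+ k) 0.
    by apply: hc; rewrite normc_rc ger0_norm ?(ltW t0)//; lra.
  by apply: le_trans (h t2 ht) _; rewrite mulrC ler_wpM2r.
elim: k c => [|k IH] c hc; first exact: head.
have c0 := head c hc.
apply: (IH (fun k => c k.+1)) => p p0 pr.
have pn0 : p != 0 by rewrite -normc_gt0.
have := sums_toZ p^-1 (sums_to_shift (hc p p0 pr)).
rewrite c0 mul0r subr0 mulr0.
by under eq_fun do rewrite exprS mulrCA mulKf//.
Qed.

Lemma series_unique c c' (f : C -> C) r : 0 < r ->
  (forall p, N p < r -> sums_to (fun k => c k * p ^+ k) (f p)) ->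
  (forall p, N p < r -> sums_to (fun k => c' k * p ^+ k) (f p)) ->
  c = c'.
Proof.
move=> r0 h h'; apply/funext => k; apply/eqP; rewrite -subr_eq0; apply/eqP.
apply: (@series_zero (fun k => c k - c' k) r r0) => p _ pr.
have := sums_toB (h p pr) (h' p pr); rewrite subrr.
by under eq_fun do rewrite -mulrBl.
Qed.

Lemma series_split c t l : sums_to (fun k => c k * t ^+ k) l ->
  exists2 m, sums_to (fun k => c k.+1 * t ^+ k) m & l = c 0%N + t * m.
Proof.
have [->|t0] := eqVneq t 0 => h.
  exists (c 1%N); first exact: (sums_to_at0 (fun k => c k.+1)).
  by rewrite mul0r addr0; exact: sums_to_unique h (sums_to_at0 c).
exists (t^-1 * (l - c 0%N)); last by rewrite mulVKf// addrC subrK.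
have := sums_toZ t^-1 (sums_to_shift h); rewrite expr0 mulr1.
by under eq_fun do rewrite exprS mulrCA mulKf//.
Qed.

Lemma ccont_normmax rho z : ccont (fun z => rc (Num.max rho (N z))) z.
Proof.
move=> e e0; exists e => // y ye; rewrite -rmorphB normc_rc.
have := le_normcD (y - z) z; have := le_normcD (z - y) y; rewrite !subrK.
move: ye; rewrite (normcC z y) => h1 h2 h3.
by case: (leP rho (N y)) => ?; case: (leP rho (N z)) => ?;
   rewrite ltr_norml; apply/andP; split; lra.
Qed.

(** Composition with the radial retraction onto the closed disc. *)
Lemma clamp (f : C -> C) rho s : 0 < rho -> rho < s ->
  (forall z, N z < s -> hol f z) ->
  exists g, (forall z, ccont g z) /\ (forall z, N z <= rho -> g z = f z).
Proof.
move=> rho0 rs hf; pose m z := Num.max rho (N z).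
have m0 z : 0 < m z by rewrite lt_max rho0.
pose k z := z * (rc rho * (rc (m z))^-1).
have ck z : ccont k z.
  apply: (@ccontM _ id); first exact: hol_ccont (hol_id _).
  apply: (@ccontM _ (fun=> rc rho)); first exact: hol_ccont (hol_cst _ _).
  apply: ccontV; last exact: ccont_normmax.
  by rewrite -normc_eq0 normc_rc normr_eq0 lt0r_neq0.
exists (fun z => f (k z)); split=> [z|z zr].
  apply: (@ccont_comp _ k f) => //; apply/hol_ccont/hf.
  rewrite !normcM normcV !normc_rc !ger0_norm ?(ltW rho0) ?(ltW (m0 z))//.
  rewrite (le_lt_trans _ rs)// mulrCA ler_piMr ?(ltW rho0)//.
  by rewrite ler_pdivrMr// mul1r le_max lexx orbT.
have mz : m z = rho by rewrite /m; apply/max_idPl.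
by rewrite /k mz mulfV ?mulr1// -normc_eq0 normc_rc normr_eq0 lt0r_neq0.
Qed.

Lemma disc_series (f : C -> C) r s : 0 < r -> r < s ->
  (forall z, N z < s -> hol f z) ->
  exists c : nat -> C,
    (forall p, N p < r -> sums_to (fun k => c k * p ^+ k) (f p)) /\
    ((forall z, N z = r -> f z = 0) -> forall k, c k = 0).
Proof.
move=> r0 rs hf; pose rho := (r + s) / 2.
have [rr rhos] : r < rho /\ rho < s by rewrite /rho; split; lra.
have [g [cg gf]] := clamp (lt_trans r0 rr) rhos hf.
have [|c [hc c0]] := @cauchy_series _ g rho r r0 rr cg.
  move=> z zr; have d0 : 0 < rho - N z by rewrite subr_gt0.
  apply: (@hol_near _ f g z _ d0); last exact/hf/(lt_trans zr).
  move=> y yz; rewrite gf// -(subrK z y) (le_trans (le_normcD _ _))//; lra.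
exists c; split=> [p pr|f0].
  by rewrite -gf; [exact: hc|exact: ltW (lt_trans pr rr)].
by apply: c0 => z zr; rewrite gf ?f0// zr ltW.
Qed.

(** The Cauchy coefficients see only the circle, so they all vanish. This carries identities in a
    unimodular parameter into the disc. *)
Lemma circle_zero (f : C -> C) r s p : 0 < r -> r < s ->
  (forall z, N z < s -> hol f z) -> (forall z, N z = r -> f z = 0) ->
  N p <= r -> f p = 0.
Proof.
move=> r0 rs hf f0; rewrite le_eqVlt => /predU1P[/f0//|pr].
have [c [hc c0]] := disc_series r0 rs hf.
apply: sums_to_unique (hc p pr) _ => e e0; exists 0%N => n _.
by rewrite big1 ?subr0 ?normc0// => k _; rewrite c0// mul0r.
Qed.

Lemma hol_comp (f g : C -> C) p : hol g p -> hol f (g p) -> hol (fun z => f (g z)) p.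
Proof.
move=> /holP/derivable1_diffP hg /holP/derivable1_diffP hf.
by apply/holP/derivable1_diffP; exact: differentiable_comp hg hf.
Qed.

Lemma hol_mulr (f : C -> C) a p : hol f (p * a) -> hol (fun z => f (z * a)) p.
Proof.
move=> hf; apply: (@hol_comp f (fun z => z * a)) => //.
by apply: (@holM _ id); [exact: hol_id|exact: hol_cst].
Qed.

(** Here [s] plays the role of the conjugate of [w], so that [H] is holomorphic
    in both variables.  The identity [H (x * z) s = H z (x * s)] extends from the
    unit circle to the disc of [x], so [H z s] depends on [z * s] alone. *)
Lemma invariant_series (H : C -> C -> C) :
  (forall z s, N z < 1 -> N s < 1 -> hol (H ^~ s) z) ->
  (forall z s, N z < 1 -> N s < 1 -> hol (H z) s) ->
  (forall x z s, N x = 1 -> N z < 1 -> N s < 1 -> H (x * z) (conjc x * s) = H z s) ->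
  exists a : nat -> C, forall z s, N z < 1 -> N s < 1 ->
    sums_to (fun k => a k * (z * s) ^+ k) (H z s).
Proof.
move=> hz hs inv.
have step x z s : N x <= 1 -> N z < 1 -> N s < 1 -> H (x * z) s = H z (x * s).
  move=> x1 z1 s1; pose m := Num.max (N z) (N s).
  have m0 : 0 <= m by rewrite le_max normc_ge0.
  have m1 : m < 1 by rewrite gt_max z1.
  have [zm sm] : N z <= m /\ N s <= m by rewrite !le_max !lexx orbT.
  (* Chosen so that [1 < S] and [S * m < 1]: both arguments of [H] stay in the unit disc for
     [N y < S]. *)
  pose S := 2 / (1 + m).
  have S1 : 1 < S by rewrite /S ltr_pdivlMr; lra.
  have Sm y w : N y < S -> N w <= m -> N (y * w) < 1.
    rewrite normcM /S ltr_pdivlMr; last lra.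
    move=> yS wm; have := normc_ge0 y; have := normc_ge0 w => w0 y0.
    have := ler_wpM2l y0 wm; nra.
  apply/eqP; rewrite -subr_eq0; apply/eqP.
  apply: (@circle_zero (fun y => H (y * z) s - H z (y * s)) 1 S x ltr01 S1) => //.
    move=> y yS; apply: holB.
      by apply: (@hol_mulr (H ^~ s)); apply: hz => //; exact: Sm.
    by apply: (@hol_mulr (H z)); apply: hs => //; exact: Sm.
  move=> y y1; apply/eqP; rewrite subr_eq0; apply/eqP.
  rewrite -(inv y z (y * s)) ?normcM ?y1 ?mul1r//; congr (H _ _).
  by rewrite mulrA [conjc y * y]mulrC -sqr_normc norm_normc y1 expr1n mul1r.
(* The function of the product is read off as [t] mapped to [H rho (t / rho)] on the disc of radius
   [rho]. As it does not depend on [rho], coefficients found for [rho = 1 / 2] serve up to radius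
   one, by uniqueness on the disc of radius [1 / 4]. *)
have f_eq (rho rho' : R) t : 0 < rho -> rho <= rho' -> rho' < 1 -> N t < rho ->
    H (rc rho) (t / rc rho) = H (rc rho') (t / rc rho').
  move=> rho0 rr rr1 tr.
  have rho'0 := lt_le_trans rho0 rr.
  have c0 : rc rho != 0 by rewrite -normc_eq0 normc_rc normr_eq0 lt0r_neq0.
  have c'0 : rc rho' != 0 by rewrite -normc_eq0 normc_rc normr_eq0 lt0r_neq0.
  have -> : t / rc rho' = (rc rho / rc rho') * (t / rc rho) by field; rewrite c0.
  rewrite -(step (rc rho / rc rho')).
  - by rewrite divfK.
  - by rewrite normcM normcV !normc_rc !ger0_norm ?(ltW rho0) ?(ltW rho'0)// ler_pdivrMr// mul1r.
  - by rewrite normc_rc ger0_norm// ltW.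
  - by rewrite normcM normcV normc_rc ger0_norm ?(ltW rho0)// ltr_pdivrMr// mul1r.
have ser (rho r : R) : 0 < r -> r < rho -> rho < 1 -> exists c : nat -> C,
    forall p, N p < r -> sums_to (fun k => c k * p ^+ k) (H (rc rho) (p / rc rho)).
  move=> r0 rr r1; have rho0 := lt_trans r0 rr.
  have [|c [hc _]] := @disc_series (fun t => H (rc rho) (t / rc rho)) r rho r0 rr.
    move=> t tr; apply: (@hol_mulr (H (rc rho))); apply: hs.
      by rewrite normc_rc ger0_norm// ltW.
    by rewrite normcM normcV normc_rc ger0_norm ?(ltW rho0)// ltr_pdivrMr// mul1r.
  by exists c.
have h4 : 0 < 1 / 4 :> R by rewrite divr_gt0.
have [||a ha] := ser (1 / 2) (1 / 4) h4; [lra|lra|].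
exists a => z s z1 s1.
(* With [N z <= rho] the factor [z / rho] can be moved to the second argument by [step];
   [1 / 2 <= rho] allows the comparison with [a]. *)
pose rho := Num.max (N z) (1 / 2).
have rho0 : 0 < rho by rewrite lt_max divr_gt0// orbT.
have rho1 : rho < 1 by rewrite gt_max z1; lra.
have zr : N z <= rho by rewrite le_max lexx.
have hr : 1 / 2 <= rho by rewrite le_max lexx orbT.
have c0 : rc rho != 0 by rewrite -normc_eq0 normc_rc normr_eq0 lt0r_neq0.
have tr : N (z * s) < rho.
  rewrite normcM; have := normc_ge0 z; have := normc_ge0 s; nra.
pose r := (Num.max (N (z * s)) (1 / 4) + rho) / 2.
have [r4 rr rt] : [/\ 1 / 4 < r, r < rho & N (z * s) < r].
  rewrite /r; case: (leP (N (z * s)) (1 / 4)) => ?; split; lra.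
have r0 := lt_trans h4 r4.
have [c hc] := ser rho r r0 rr rho1.
have ac : c = a.
  apply: (@series_unique c a (fun p => H (rc (1 / 2)) (p / rc (1 / 2))) _ h4) => p p4; last exact: ha.
  rewrite (@f_eq (1 / 2) rho)//; [exact/hc/(lt_trans p4)|lra].
have -> : H z s = H (rc rho) (z * s / rc rho).
  have -> : z * s / rc rho = (z / rc rho) * s by rewrite mulrAC.
  rewrite -step//.
  - by rewrite divfK.
  - by rewrite normcM normcV normc_rc ger0_norm ?(ltW rho0)// ler_pdivrMr// mul1r.
  - by rewrite normc_rc ger0_norm// ltW.
by rewrite -ac; exact: hc.
Qed.

End DiscSeries.

(** * ** * Matrix entries and convergence of matrix series *)

Section Glue.
Variable R : realType.
Local Notation C := R[i].
Local Notation N := (@normc R).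
Local Notation rc := (real_complex R).

Lemma derivable_entry m n (f : C -> 'M[C]_(m, n)) p a b :
  derivable f p 1 -> hol (fun t => f t a b) p.
Proof.
move=> /cvg_ex[/= l hl]; apply/holP/cvg_ex; exists (l a b).
have := continuous_cvg _ (@coord_continuous _ _ _ a b l) hl.
rewrite (_ : _ \o _ = (fun h : C => h^-1 *: (((fun t => f t a b) \o shift p) (h *: 1) - f p a b))).
  by apply.
by apply/funext => h; rewrite /= !mxE.
Qed.

Lemma sums_to_cvg (u : nat -> C) l : sums_to u l -> series u @ \oo --> l.
Proof.
move=> h; apply/cvgrPdist_lt => e /gt0_rc[e' e0 ->].
have [n0 hn0] := h _ e0; exists n0 => // n /= nn.
by rewrite norm_normc ltcR normcC /series /= big_mkord hn0.
Qed.

(** For fixed [z] and [w] every term is a combination of the two matrices [1%:M] and [z *m adjmx w],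
    so convergence reduces to two scalar series. *)
Lemma series_mx_cvg d (u v : nat -> C) l m (A B : 'M[C]_d) (S : nat -> 'M[C]_d) :
  sums_to u l -> sums_to v m -> (forall j, S j = u j *: A + v j *: B) ->
  [series S j]_j @ \oo --> l *: A + m *: B.
Proof.
move=> /sums_to_cvg hu /sums_to_cvg hv hS.
have -> : [series S j]_j = (fun n => series u n *: A + series v n *: B).
  apply/funext => n; rewrite /series /= !scaler_suml -big_split /=.
  by apply: eq_bigr => j _; rewrite hS.
by apply: cvgD; [exact: (cvgZr_tmp hu)|exact: (cvgZr_tmp hv)].
Qed.

Lemma geometric_sums (u : nat -> C) (M x : R) : 0 <= x -> x < 1 ->
  (forall k, N (u k) <= M * x ^+ k) -> exists l, sums_to u l.
Proof.
move=> x0 x1 hu.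
have gc : cvgn (series (fun k => M * x ^+ k)).
  by apply: is_cvg_geometric_series; rewrite ger0_norm.
have real_cvg (g : C -> R) : (forall z, `|g z| <= N z) ->
    cvgn (series (fun k => g (u k))).
  move=> hg; apply: normed_cvg.
  by apply: series_le_cvg gc => k //=; [rewrite (le_trans (normc_ge0 (u k)))|rewrite (le_trans (hg _))].
have hRe := real_cvg _ (@normc_Re R); have hIm := real_cvg _ (@normc_Im R).
exists (pt (limn (series (fun k => Re (u k)))) (limn (series (fun k => Im (u k))))).
move=> e e0; have e20 : 0 < e / 2 by rewrite divr_gt0.
have /cvgrPdist_lt /(_ _ e20) [n1 _ h1] := hRe.
have /cvgrPdist_lt /(_ _ e20) [n2 _ h2] := hIm.
exists (maxn n1 n2) => n; rewrite geq_max => /andP[/h1 /= {}h1 /h2 /= {}h2].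
rewrite (ptE (\sum_(k < n) u k)) ptB (le_lt_trans (normc_pt _ _))//.
move: h1 h2; rewrite /series /= !big_mkord.
have -> : Re (\sum_(k < n) u k) = \sum_(k < n) Re (u k).
  exact: (raddf_sum (@complex.Re R : {additive Rcomplex R -> R})).
have -> : Im (\sum_(k < n) u k) = \sum_(k < n) Im (u k).
  exact: (raddf_sum (@complex.Im R : {additive Rcomplex R -> R})).
by rewrite distrC => h1; rewrite distrC => h2; lra.
Qed.

End Glue.

(** * Unitary matrices and the ball *)

Section Unitary.
Variable R : realType.
Local Notation C := R[i].
Local Notation N := (@normc R).
Local Notation rc := (real_complex R).

Lemma adjmxE m n (A : 'M[C]_(m, n)) i j : adjmx A i j = (A j i)^*.
Proof. by rewrite !mxE. Qed.

Lemma adjmxM m n p (A : 'M[C]_(m, n)) (B : 'M[C]_(n, p)) :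
  adjmx (A *m B) = adjmx B *m adjmx A.
Proof.
apply/matrixP => i j; rewrite adjmxE !mxE rmorph_sum; apply: eq_bigr => k _.
by rewrite !adjmxE rmorphM mulrC.
Qed.

Lemma adjmxK m n (A : 'M[C]_(m, n)) : adjmx (adjmx A) = A.
Proof. by apply/matrixP => i j; rewrite !adjmxE conjCK. Qed.

Lemma cinnerE d (z w : 'cV[C]_d) : cinner z w = (adjmx w *m z) 0 0.
Proof. by rewrite mxE; apply: eq_bigr => i _; rewrite adjmxE mulrC. Qed.

Lemma unitary_adjK d (u : 'M[C]_d) : unitary u -> adjmx u *m u = 1%:M.
Proof. exact: mulmx1C. Qed.

Lemma unitary_adj d (u : 'M[C]_d) : unitary u -> unitary (adjmx u).
Proof. by move=> hu; rewrite /unitary /= adjmxK unitary_adjK. Qed.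

Lemma cinner_unitary d (u : 'M[C]_d) z w : unitary u ->
  cinner (u *m z) (u *m w) = cinner z w.
Proof.
by move=> hu; rewrite !cinnerE adjmxM mulmxA -(mulmxA (adjmx w)) unitary_adjK// mulmx1.
Qed.

Lemma cballE d (z : 'cV[C]_d) : cball z <-> \sum_i N (z i 0) ^+ 2 < 1.
Proof.
rewrite /cball /= (_ : \sum_i _ = rc (\sum_i N (z i 0) ^+ 2)).
  by rewrite -(rmorph1 rc) ltcR.
by rewrite rmorph_sum; apply: eq_bigr => i _; rewrite rmorphXn.
Qed.

Lemma cball_cinner d (z : 'cV[C]_d) : cball z <-> cinner z z < 1.
Proof.
rewrite /cball /= (_ : \sum_i _ = cinner z z)//.
by apply: eq_bigr => i _; rewrite sqr_normc.
Qed.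

Lemma cball_unitary d (u : 'M[C]_d) z : unitary u -> cball z -> cball (u *m z).
Proof. by move=> hu /cball_cinner hz; apply/cball_cinner; rewrite cinner_unitary. Qed.

Lemma cball_le d (z y : 'cV[C]_d) :
  (forall i, N (y i 0) <= N (z i 0)) -> cball z -> cball y.
Proof.
move=> h /cballE hz; apply/cballE; apply: le_lt_trans hz; apply: ler_sum => i _.
by rewrite ler_pXn2r ?nnegrE ?normc_ge0.
Qed.

Lemma cball_dilate d (z : 'cV[C]_d) : cball z -> exists2 S, 1 < S &
  forall y : 'cV[C]_d, (forall i, N (y i 0) <= S * N (z i 0)) -> cball y.
Proof.
move=> /cballE; set Q := \sum_i _ => Q1.
have Q0 : 0 <= Q by apply: sumr_ge0 => i _; exact: sqr_ge0.
(* [S ^ 2 * Q = 4 * Q / (1 + Q) ^ 2] is below [1] because [(1 - Q) ^ 2] is positive. *)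
exists (2 / (1 + Q)); first by rewrite ltr_pdivlMr; lra.
move=> y hy; apply/cballE.
have S0 : 0 <= 2 / (1 + Q) by rewrite divr_ge0// addr_ge0.
apply: (@le_lt_trans _ _ ((2 / (1 + Q)) ^+ 2 * Q)).
  rewrite /Q mulr_sumr; apply: ler_sum => i _; rewrite -exprMn.
  by rewrite ler_pXn2r ?nnegrE ?(mulr_ge0 S0) ?normc_ge0.
rewrite exprMn exprVn mulrAC ltr_pdivrMr; last by rewrite exprn_gt0// ltr_wpDr.
by have := mulr_gt0 (_ : 0 < 1 - Q) (_ : 0 < 1 - Q); rewrite subr_gt0 => /(_ Q1 Q1); lra.
Qed.

Lemma normc_coord d (z : 'cV[C]_d) i : cball z -> N (z i 0) < 1.
Proof.
move=> /cballE hz; rewrite -(@ltr_pXn2r _ 2)// ?nnegrE ?normc_ge0// expr1n.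
apply: le_lt_trans hz; rewrite (bigD1 i)//= lerDl.
by apply: sumr_ge0 => j _; exact: sqr_ge0.
Qed.

Definition axis n (s : C) : 'cV[C]_n.+1 := s *: evec R ord0.

Lemma axisE n s i : axis n s i 0 = if i == ord0 then s else 0.
Proof. by rewrite !mxE eqxx andbT; case: (i == ord0); rewrite ?mulr1 ?mulr0. Qed.

Lemma cball_axis n s : cball (axis n s) <-> N s < 1.
Proof.
rewrite cballE (bigD1 ord0)//= axisE eqxx big1 ?addr0.
  by rewrite -{1}(expr1n _ 2) ltr_pXn2r// nnegrE// normc_ge0.
by move=> i /negbTE i0; rewrite axisE i0 normc0 expr0n.
Qed.

Lemma cinner_axis n (z : 'cV[C]_n.+1) s : cinner z (axis n s) = z ord0 0 * s^*.
Proof.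
rewrite /cinner (bigD1 ord0)//= axisE eqxx big1 ?addr0//.
by move=> i /negbTE i0; rewrite axisE i0 conjC0 mulr0.
Qed.

(** Gram-Schmidt is applied to the matrix all of whose rows are the transpose of [z]: the result is
    unitary even for dependent rows, and its first row spans a line containing the first given
    row. *)
Lemma unitary_axis n (z : 'cV[C]_n.+1) :
  exists (u : 'M[C]_n.+1) c, unitary u /\ z = u *m axis n c.
Proof.
pose A : 'M[C]_n.+1 := \matrix_(i, j) z j 0.
pose S := schmidt A.
have SU : S \is unitarymx by exact: schmidt_unitarymx.
have : (row ord0 A <= row ord0 S)%MS.
  apply: submx_trans (row_schmidt_sub A ord0) _; apply/sumsmx_subP => k.
  rewrite leqn0 => /eqP k0; rewrite genmxE (_ : k = ord0)//.
  exact/val_inj.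
move=> /sub_rVP[c hc]; exists S^T, c; split.
  by move: SU; rewrite -trmx_unitary => /unitarymxP; rewrite /unitary /= /adjmx map_trmx.
apply/matrixP => i j; rewrite (ord1 j).
have /rowP /(_ i) := hc; rewrite !mxE => ->.
rewrite (bigD1 ord0)//= axisE eqxx mxE big1 ?addr0 1?mulrC//.
by move=> k /negbTE k0; rewrite axisE k0 mulr0.
Qed.

Lemma conj_mul_unimod (x : C) : N x = 1 -> x * x^* = 1.
Proof. by move=> x1; rewrite -normCK norm_normc x1 expr1n. Qed.

Lemma unitary_diag d (v : 'rV[C]_d) : (forall i, N (v 0 i) = 1) ->
  unitary (diag_mx v).
Proof.
move=> hv; apply/matrixP => i j; rewrite mul_diag_mx mxE adjmxE !mxE.
have [->|ij] := eqVneq i j; first by rewrite !mulr1n conj_mul_unimod.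
by rewrite !mulr0n conjC0 mulr0.
Qed.

End Unitary.

(** * Invariant kernels *)

Section Kernel.
Variables (R : realType) (n : nat).
Local Notation C := R[i].
Local Notation N := (@normc R).
Local Notation rc := (real_complex R).
Variable K : 'cV[C]_n.+1 -> 'cV[C]_n.+1 -> 'M[C]_n.+1.
Hypothesis hs : sesqui_analytic K.
Hypothesis hh : hermitian_kernel K.
Hypothesis hq : quasi_invariant_id K.

Lemma quasi u z w : unitary u -> cball z -> cball w ->
  K (u *m z) (u *m w) = u *m K z w *m adjmx u.
Proof.
move=> hu hz hw; have [uu _] := mulmx1_unit hu.
by rewrite -(hq hu (cball_unitary hu hz) (cball_unitary hu hw)) !mulKmx.
Qed.

Lemma herm z w a b : cball z -> cball w -> K z w a b = (K w z b a)^*.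
Proof. by move=> hz hw; rewrite -adjmxE hh. Qed.

Lemma torus (v : 'rV[C]_n.+1) z w a b : (forall i, N (v 0 i) = 1) ->
  cball z -> cball w ->
  K (diag_mx v *m z) (diag_mx v *m w) a b = v 0 a * K z w a b * (v 0 b)^*.
Proof.
move=> hv hz hw; rewrite quasi//; last exact: unitary_diag.
have -> : adjmx (diag_mx v) = diag_mx (\row_i (v 0 i)^*).
  apply/matrixP => i j; rewrite adjmxE !mxE eq_sym.
  by have [->|_] := eqVneq i j; rewrite ?mulr1n// !mulr0n conjC0.
by rewrite mul_mx_diag mul_diag_mx !mxE.
Qed.

Definition upd (k : 'I_n.+1) (z : 'cV[C]_n.+1) (x : C) : 'cV[C]_n.+1 :=
  \col_i (if i == k then x else z i 0).

Lemma updE k z x i : upd k z x i 0 = if i == k then x else z i 0.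
Proof. by rewrite mxE. Qed.

Lemma upd_id k z : upd k z (z k 0) = z.
Proof.
by apply/matrixP => i j; rewrite (ord1 j) updE; case: eqP => [->|].
Qed.

Lemma upd_line k z x y : upd k z x = upd k z y + (x - y) *: evec R k.
Proof.
apply/matrixP => i j; rewrite (ord1 j) !mxE eqxx andbT.
by case: (i == k); rewrite ?mulr1 ?mulr0 ?addr0// addrC subrK.
Qed.

Lemma axis_upd x : axis n x = upd ord0 0 x.
Proof. by apply/matrixP => i j; rewrite (ord1 j) axisE updE mxE. Qed.

Lemma hol_upd1 k z w a b x0 : cball (upd k z x0) -> cball w ->
  hol (fun x => K (upd k z x) w a b) x0.
Proof.
move=> hz hw; have [_ /(_ k) /(derivable_entry a b) h _] := hs hz hw.
rewrite (_ : (fun x => _) = (fun x => (fun t => K (upd k z x0 + t *: evec R k) w a b) (x - x0))).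
  apply: (@hol_comp _ (fun t => K (upd k z x0 + t *: evec R k) w a b) (fun x => x - x0)).
    exact: (@holB _ id _ _ (hol_id _) (hol_cst _ _)).
  by rewrite subrr.
by apply/funext => x; rewrite -upd_line.
Qed.

Lemma hol_upd2 k z w a b x0 : cball z -> cball (upd k w x0^*) ->
  hol (fun x => K z (upd k w x^*) a b) x0.
Proof.
move=> hz hw; have [_ _ /(_ k) /(derivable_entry a b) h] := hs hz hw.
rewrite (_ : (fun x => _) = (fun x => (fun t => K z (upd k w x0^* + t^* *: evec R k) a b) (x - x0))).
  apply: (@hol_comp _ (fun t => K z (upd k w x0^* + t^* *: evec R k) a b) (fun x => x - x0)).
    exact: (@holB _ id _ _ (hol_id _) (hol_cst _ _)).
  by rewrite subrr.
by apply/funext => x; rewrite rmorphB -upd_line.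
Qed.

Lemma torus_upd k z s a b x : k != ord0 -> cball z -> N s < 1 -> N x = 1 ->
  K (upd k z (x * z k 0)) (axis n s) a b =
  (if a == k then x else 1) * K z (axis n s) a b * (if b == k then x^* else 1).
Proof.
move=> k0 hz hs1 x1; pose v : 'rV[C]_n.+1 := \row_i (if i == k then x else 1).
have hv i : N (v 0 i) = 1 by rewrite mxE; case: ifP => _ //; exact: normc1.
have -> : upd k z (x * z k 0) = diag_mx v *m z.
  apply/matrixP => i j; rewrite (ord1 j) updE mul_diag_mx !mxE.
  by case: eqP => [->|]; rewrite ?mul1r.
rewrite -{1}(_ : diag_mx v *m axis n s = axis n s).
  by rewrite torus//; [rewrite !mxE; congr (_ * _); case: ifP; rewrite ?conjC1|exact/cball_axis].
apply/matrixP => i j; rewrite (ord1 j) mul_diag_mx mxE axisE mxE.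
by have [->|] := eqVneq i ord0; rewrite ?mulr0// eq_sym (negbTE k0) mul1r.
Qed.

Lemma upd_disc k z : cball z -> exists2 S, 1 < S & forall x, N x < S ->
  cball (upd k z (x * z k 0)).
Proof.
move=> /cball_dilate[S S1 hS]; exists S => // x xS; apply: hS => i.
rewrite updE; case: eqP => [->|_].
  by rewrite normcM ler_wpM2r ?normc_ge0// ltW.
by rewrite ler_peMl ?normc_ge0// ltW.
Qed.

Lemma hol_scale k z w a b (x0 : C) : cball (upd k z (x0 * z k 0)) -> cball w ->
  hol (fun x => K (upd k z (x * z k 0)) w a b) x0.
Proof.
move=> hz hw; apply: (@hol_mulr _ (fun y => K (upd k z y) w a b)).
exact: hol_upd1.
Qed.

(** Multiplying [z b] by a unimodular [x] multiplies the entry by the conjugate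
    of [x]; so [x] times the entry is constant in [x], and it vanishes at
    [x = 0]. *)
Lemma off_diag z s a b : a != b -> b != ord0 -> cball z -> N s < 1 ->
  K z (axis n s) a b = 0.
Proof.
move=> ab b0 hz s1; have [S S1 hS] := upd_disc b hz.
have hw : cball (axis n s) by exact/cball_axis.
have := @circle_zero R (fun x => x * K (upd b z (x * z b 0)) (axis n s) a b -
  K z (axis n s) a b) 1 S 0 ltr01 S1.
rewrite mul0r sub0r normc0 => h; apply/oppr_inj; rewrite oppr0; apply: h => //.
- move=> x xS; apply: holB; last exact: hol_cst.
  by apply: (@holM _ id); [exact: hol_id|apply: hol_scale => //; exact: hS].
- move=> x x1; rewrite torus_upd// eqxx (negbTE ab) mul1r mulrCA.
  by rewrite conj_mul_unimod// mulr1 subrr.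
Qed.

(** In a diagonal entry the factors [x] and its conjugate cancel on the circle, or neither occurs.
    The entry is thus constant for [x] in the disc, and [x = 0] erases the coordinate. *)
Lemma diag_upd k z s a : k != ord0 -> cball z -> N s < 1 ->
  K z (axis n s) a a = K (upd k z 0) (axis n s) a a.
Proof.
move=> k0 hz s1; have [S S1 hS] := upd_disc k hz.
have hw : cball (axis n s) by exact/cball_axis.
have := @circle_zero R (fun x => K (upd k z (x * z k 0)) (axis n s) a a -
  K z (axis n s) a a) 1 S 0 ltr01 S1.
rewrite mul0r normc0 => h; apply/eqP; rewrite eq_sym -subr_eq0; apply/eqP; apply: h => //.
- move=> x xS; apply: holB; last exact: hol_cst.
  by apply: hol_scale => //; exact: hS.
- move=> x x1; rewrite torus_upd//; case: ifP => _; last by rewrite mul1r mulr1 subrr.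
  by rewrite mulrAC conj_mul_unimod// mul1r subrr.
Qed.

Lemma diag_axis z s a : cball z -> N s < 1 ->
  K z (axis n s) a a = K (axis n (z ord0 0)) (axis n s) a a.
Proof.
move=> hz s1.
pose zs (l : seq 'I_n.+1) := foldr (fun k y => upd k y 0) z l.
have zsE l i : zs l i 0 = if i \in l then 0 else z i 0.
  elim: l => [//|k l IH] /=; rewrite updE in_cons IH.
  by case: (i == k).
have hzs l : cball (zs l).
  apply: cball_le hz => i; rewrite zsE; case: ifP => // _.
  by rewrite normc0 normc_ge0.
have step l : ord0 \notin l -> K z (axis n s) a a = K (zs l) (axis n s) a a.
  elim: l => [//|k l IH]; rewrite in_cons negb_or => /andP[k0 /IH ->] /=.
  by rewrite -diag_upd// eq_sym.
rewrite (step [seq i <- enum 'I_n.+1 | i != ord0]); last by rewrite mem_filter eqxx.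
congr (K _ _ _ _); apply/matrixP => i j; rewrite (ord1 j) zsE axisE.
by rewrite mem_filter mem_enum andbT; case: eqP => [->|].
Qed.

(** Exchanging two coordinates other than the first is unitary and fixes the axis. *)
Lemma diag_perm z s a b : a != ord0 -> b != ord0 -> N z < 1 -> N s < 1 ->
  K (axis n z) (axis n s) a a = K (axis n z) (axis n s) b b.
Proof.
move=> a0 b0 z1 s1; pose u : 'M[C]_n.+1 := tperm_mx a b.
have uT : adjmx u = u.
  apply/matrixP => i j; rewrite adjmxE !mxE.
  rewrite (_ : (tperm a b i == j) = (tperm a b j == i)).
    by case: eqP => _; rewrite ?conjC1 ?conjC0.
  by apply/eqP/eqP => <-; rewrite tpermK.
have hu : unitary u by rewrite /unitary /= uT /u /tperm_mx -perm_mxM tperm2 perm_mx1.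
have fixu x : u *m axis n x = axis n x.
  apply/matrixP => i j; rewrite (ord1 j) /u /tperm_mx -row_permE mxE !axisE.
  by case: tpermP => [->|->|]//; rewrite (negbTE a0) (negbTE b0).
rewrite -{1}(fixu z) -{1}(fixu s) quasi//; [|exact/cball_axis..].
have uE : u = perm_mx (tperm a b)^-1 by rewrite tpermV.
by rewrite uT {2}uE -col_permE mxE /u /tperm_mx -row_permE mxE tpermL.
Qed.

(** Unimodular scalar matrices preserve the axis and commute with every matrix, which gives the
    circle invariance; conjugating [s] makes the entry holomorphic in both variables. *)
Lemma diag_series a : exists c : nat -> C, forall z s, N z < 1 -> N s < 1 ->
  sums_to (fun k => c k * (z * s^*) ^+ k) (K (axis n z) (axis n s) a a).
Proof.
have [] := @invariant_series R (fun z s => K (axis n z) (axis n s^*) a a).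
- move=> z s z1 s1 /=.
  have <- : (fun x => K (upd ord0 0 x) (axis n s^*) a a) =
      (fun x => K (axis n x) (axis n s^*) a a).
    by apply/funext => x; rewrite (axis_upd x).
  by apply: hol_upd1; [rewrite -axis_upd; exact/cball_axis|apply/cball_axis; rewrite normc_conj].
- move=> z s z1 s1 /=.
  have <- : (fun x => K (axis n z) (upd ord0 0 x^*) a a) =
      (fun x => K (axis n z) (axis n x^*) a a).
    by apply/funext => x; rewrite (axis_upd x^*).
  by apply: hol_upd2; [exact/cball_axis|rewrite -axis_upd; apply/cball_axis; rewrite normc_conj].
- move=> x z s x1 z1 s1; pose v : 'rV[C]_n.+1 := const_mx x.
  have scale y : axis n (x * y) = diag_mx v *m axis n y.
    apply/matrixP => i j; rewrite (ord1 j) mul_diag_mx [RHS]mxE [v 0 i]mxE !axisE.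
    by case: eqP; rewrite ?mulr0.
  have -> : (conjc x * s)^* = x * s^* by rewrite rmorphM -[in RHS](conjCK x).
  rewrite !scale torus; [|by move=> i; rewrite mxE|exact/cball_axis|].
    by rewrite mxE mulrAC conj_mul_unimod// mul1r.
  by apply/cball_axis; rewrite normc_conj.
- move=> c hc; exists c => z s z1 s1; have := hc z s^* z1.
  by rewrite normc_conj conjCK => /(_ s1).
Qed.

End Kernel.

(** * ** * The first column and the shape of the kernel *)

Section Structure.
Variables (R : realType) (n : nat).
Local Notation C := R[i].
Local Notation N := (@normc R).
Local Notation rc := (real_complex R).
Variable K : 'cV[C]_n.+1 -> 'cV[C]_n.+1 -> 'M[C]_n.+1.
Hypothesis hs : sesqui_analytic K.
Hypothesis hh : hermitian_kernel K.
Hypothesis hq : quasi_invariant_id K.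
Local Notation axis := (@axis R n).

(** Move [z] to the axis by a unitary [u]: by Hermitian symmetry all rows of the
    moved kernel but the first are those of [al%:M].  Hence the first column of
    [K z w - al%:M] is a multiple of the first column of [u], as [z] is. *)
Lemma column_relation z s i1 x : i1 != ord0 -> x != ord0 -> cball z -> N s < 1 ->
  z ord0 0 * K z (axis s) x ord0 =
  z x 0 * (K (axis (z ord0 0)) (axis s) ord0 ord0 -
           K (axis (z ord0 0)) (axis s) i1 i1).
Proof.
move=> i10 x0 hz s1; set al := K _ _ i1 i1.
have hw : cball (axis s) by exact/cball_axis.
have [a ha] := diag_series hs hq i1.
have [u [c [hu zE]]] := unitary_axis z.
have hu' := unitary_adj hu.
pose w' := adjmx u *m axis s.
have hw' : cball w' by exact: cball_unitary.
have uw' : u *m w' = axis s by rewrite mulmxA hu mul1mx.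
have hc : cball (axis c).
  have -> : axis c = adjmx u *m z by rewrite zE mulmxA unitary_adjK// mul1mx.
  exact: cball_unitary.
have c1 : N c < 1 by exact: (cball_axis n c).1 hc.
have w1 : N (w' ord0 0) < 1 by exact: normc_coord.
have z1 : N (z ord0 0) < 1 by exact: normc_coord.
have inner : z ord0 0 * s^* = c * (w' ord0 0)^*.
  rewrite -cinner_axis -uw' zE cinner_unitary// /cinner (bigD1 ord0)//= axisE eqxx.
  by rewrite big1 ?addr0// => i /negbTE i0; rewrite axisE i0 mul0r.
pose M := K (axis c) w'.
(* By [inner], both values are sums of the same series at the same point. *)
have alE : K (axis c) (axis (w' ord0 0)) i1 i1 = al.
  have h1 := ha _ _ c1 w1; have h2 := ha _ _ z1 s1.
  by rewrite inner in h2; exact: sums_to_unique h1 h2.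
have rowM k l : k != ord0 -> M k l = al *+ (k == l).
  move=> k0; rewrite /M (herm hh)//; have [<-|kl] := eqVneq k l; last first.
    by rewrite (off_diag hs hq)// 1?eq_sym// conjC0.
  rewrite (diag_axis hs hq)// mulr1n -(herm hh)//; last exact/cball_axis.
  by rewrite (diag_perm hq k0 i10)// alE.
pose X := K z (axis s) - al%:M; pose Y := M - al%:M.
have XE : X = u *m (Y *m adjmx u).
  rewrite /X /Y mulmxBl mulmxBr mulmxA -quasi// uw' -zE; congr (_ - _).
  by rewrite mul_scalar_mx -scalemxAr hu scalemx1.
pose ka := (Y *m adjmx u) ord0 ord0.
have colX k : X k ord0 = u k ord0 * ka.
  rewrite XE mxE (bigD1 ord0)//= big1 ?addr0// => l l0.
  rewrite [(Y *m _) l _]mxE big1 ?mulr0// => j _.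
  by rewrite /Y !mxE [M l j]rowM// subrr mul0r.
have zk k : z k 0 = u k ord0 * c.
  rewrite zE mxE (bigD1 ord0)//= axisE eqxx big1 ?addr0// => l /negbTE l0.
  by rewrite axisE l0 mulr0.
(* Cross-multiplication eliminates [ka] and [c] without dividing by quantities that may vanish. *)
have h0 := colX ord0; have hx := colX x.
rewrite /X !mxE eqxx mulr1n in h0; rewrite /X !mxE (negbTE x0) mulr0n subr0 in hx.
rewrite -(diag_axis hs hq)//.
by rewrite h0 hx !zk; ring.
Qed.

Lemma structure_axis : exists a g : nat -> C, forall z s, cball z -> N s < 1 ->
  exists al ga, [/\ sums_to (fun k => a k * (z ord0 0 * s^*) ^+ k) al,
    sums_to (fun k => g k * (z ord0 0 * s^*) ^+ k) ga &
    K z (axis s) = al%:M + ga *: (z *m adjmx (axis s))].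
Proof.
have [b hb] := diag_series hs hq ord0.
have outer z s x y : (z *m adjmx (axis s)) x y = z x 0 * (if y == ord0 then s^* else 0).
  rewrite mxE big_ord1 adjmxE axisE; case: ifP => // _; by rewrite conjC0.
have [i1 i10|all0] := pickP (fun i : 'I_n.+1 => i != ord0); last first.
  (* Dimension one: the constant term goes to the identity matrix and the rest to [z w^*]. *)
  exists (fun k => if k == 0%N then b 0%N else 0), (fun k => b k.+1) => z s hz s1.
  have [m hm bE] := series_split (hb _ _ (normc_coord ord0 hz) s1).
  exists (b 0%N), m; split=> //.
    move=> e e0; exists 1%N => -[//|k] _; rewrite big_ord_recl expr0 mulr1 big1.
      by rewrite addr0 subrr normc0.
    by move=> j _; rewrite mul0r.
  apply/matrixP => i j.
  have i0 k : k = ord0 :> 'I_n.+1 by have := all0 k; move=> /negbFE/eqP.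
  rewrite (i0 i) (i0 j) (diag_axis hs hq)// bE [in RHS]mxE [X in _ = _ + X]mxE outer.
  by rewrite !mxE eqxx mulr1n; ring.
have [a ha] := diag_series hs hq i1.
pose c k := b k - a k; pose g k := c k.+1.
have hc z s : N z < 1 -> N s < 1 -> sums_to (fun k => c k * (z * s^*) ^+ k)
    (K (axis z) (axis s) ord0 ord0 - K (axis z) (axis s) i1 i1).
  move=> z1 s1; have := sums_toB (hb z s z1 s1) (ha z s z1 s1).
  by under eq_fun do rewrite -mulrBl.
have N0 : N 0 < 1 by rewrite normc0.
have half0 : (2^-1 : C) != 0 by rewrite invr_eq0 pnatr_eq0.
have half : 2^-1 = rc 2^-1 by rewrite fmorphV rmorph_nat.
have Nhalf : N 2^-1 = 2^-1 by rewrite half normc_rc ger0_norm// invr_ge0.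
have Nhalf1 : N 2^-1 < 1 by rewrite Nhalf; lra.
(* The column relation at half the basis vector [i1] and [s = 0] has left side zero and forces the
   two diagonal entries to agree at the origin. *)
have c0 : c 0%N = 0.
  pose z : 'cV[C]_n.+1 := upd i1 0 2^-1.
  have zE i : z i 0 = if i == i1 then 2^-1 else 0 by rewrite updE mxE.
  have hz : cball z.
    apply/cballE; rewrite (bigD1 i1)//= zE eqxx Nhalf big1 ?addr0; first lra.
    by move=> i /negbTE ii; rewrite zE ii normc0 expr0n.
  have := column_relation i10 i10 hz N0.
  rewrite !zE eqxx eq_sym (negbTE i10) mul0r => /esym/eqP.
  rewrite mulf_eq0 (negbTE half0) /= => /eqP E.
  by have := hc 0 0 N0 N0; rewrite E mul0r => h; exact: sums_to_unique (sums_to_at0 c) h.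
exists a, g => z s hz s1.
have z1 := normc_coord ord0 hz.
have diff y : N y < 1 -> exists2 ga, sums_to (fun k => g k * (y * s^*) ^+ k) ga &
    K (axis y) (axis s) ord0 ord0 - K (axis y) (axis s) i1 i1 = y * s^* * ga.
  move=> y1; have [ga hga E] := series_split (hc y s y1 s1).
  by exists ga => //; rewrite E c0 add0r.
have [ga hga BA] := diff _ z1.
exists (K (axis (z ord0 0)) (axis s) i1 i1), ga; split=> //; first exact: ha.
have column x : x != ord0 -> K z (axis s) x ord0 = s^* * ga * z x 0.
  move=> x0; have [zz|zn0] := eqVneq (z ord0 0) 0; last first.
    by apply: (mulfI zn0); rewrite (column_relation i10 x0)// BA; ring.
  have gaE : ga = g 0%N.
    by rewrite zz mul0r in hga; exact: sums_to_unique hga (sums_to_at0 g).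
  (* At [z ord0 0 = 0] the column relation is void: pass to the limit in the
     first coordinate of [z]. *)
  have [m4 hm4 _] := series_split (hc _ _ Nhalf1 Nhalf1).
  have r0 : 0 < 2^-1 * 2^-1 :> R by rewrite mulr_gt0 ?invr_gt0.
  have q4 : 2^-1 * 2^-1^* = rc (2^-1 * 2^-1) by rewrite half -[_^*]/(conjc _) conjc_rc -rmorphM.
  rewrite q4 in hm4.
  have [K0 K00 hK0] := series_lipschitz0 r0 hm4.
  pose phi y := K (upd ord0 z y) (axis s) x ord0.
  have phi0 : phi 0 = K z (axis s) x ord0 by rewrite /phi -{1}zz upd_id.
  have cphi : ccont phi 0.
    apply/hol_ccont/(hol_upd1 hs); last exact/cball_axis.
    by rewrite -{1}zz upd_id.
  have /cballE := hz; set Q := \sum_i _ => Q1.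
  have hball y : N y < 1 - Q -> cball (upd ord0 z y).
    move=> yQ; have Q0 : 0 <= Q by apply: sumr_ge0 => i _; exact: sqr_ge0.
    apply/cballE; rewrite (bigD1 ord0)//= updE eqxx.
    rewrite (eq_bigr (fun i => N (z i 0) ^+ 2)) => [|i /negbTE i0]; last by rewrite updE i0.
    move: Q1 yQ Q0; rewrite /Q (bigD1 ord0)//= zz normc0 expr0n add0r => Q1 yQ Q0.
    have y0 := normc_ge0 y.
    have : N y ^+ 2 <= N y by rewrite expr2 ler_piMr//; lra.
    by lra.
  apply/eqP; rewrite -subr_eq0; apply/eqP.
  pose L := N (s^* * z x 0) * K0.
  have L0 : 0 <= L by rewrite mulr_ge0 ?normc_ge0.
  apply: (@le_any_eq0 _ _ (1 + L)); first by rewrite addr_ge0.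
  move=> e e0; have [d d0 hd] := cphi _ e0.
  (* Below [d] for the continuity of [phi], below [1 - Q] to stay in the ball, at most [1 / 8]
     because the Lipschitz bound at radius [1 / 4] covers half that radius, and at most [e] for the
     final estimate. *)
  pose t := Num.min (Num.min e (d / 2)) (Num.min ((1 - Q) / 2) (1 / 8)).
  have t0 : 0 < t by rewrite !min_gt0 ?divr_gt0 ?subr_gt0.
  have te : t <= e by rewrite /t !ge_min lexx.
  have td : t < d.
    by apply: (@le_lt_trans _ _ (d / 2)); [rewrite /t !ge_min lexx !orbT|lra].
  have tQ : t < 1 - Q.
    by apply: (@le_lt_trans _ _ ((1 - Q) / 2)); [rewrite /t !ge_min lexx !orbT|lra].
  have t8 : t <= 1 / 8 by rewrite /t !ge_min lexx !orbT.
  pose y := rc t.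
  have Ny : N y = t by rewrite normc_rc ger0_norm// ltW.
  have yn0 : y != 0 by rewrite -normc_gt0 Ny.
  have y1 : N y < 1 by rewrite Ny; lra.
  have [gy hgy Ey] := diff y y1.
  have phiy : phi y = s^* * gy * z x 0.
    have hy : cball (upd ord0 z y) by apply: hball; rewrite Ny.
    apply: (mulfI yn0); have := column_relation i10 x0 hy s1.
    by rewrite !updE eqxx (negbTE x0) Ey => ->; ring.
  have Nys : N (y * s^*) <= t.
    by rewrite normcM Ny normc_conj ler_piMr ?ltW.
  have hL := hK0 _ _ _ hgy.
  rewrite gaE -phi0.
  have -> : phi 0 - s^* * g 0%N * z x 0 =
    - (phi y - phi 0) + s^* * z x 0 * (gy - g 0%N) by rewrite phiy; ring.
  rewrite (le_trans (le_normcD _ _))// normcN (mulrDr e) mulr1 lerD//.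
    by apply/ltW/hd; rewrite subr0 Ny.
  rewrite normcM /L mulrCA ler_wpM2l ?normc_ge0//.
  apply: (@le_trans _ _ (K0 * N (y * s^*))); first by apply: hL; lra.
  by rewrite mulrC ler_wpM2r// (le_trans Nys).
apply/matrixP => x y; rewrite mxE [X in _ = _ + X]mxE outer mxE.
have [->|y0] := eqVneq y ord0; last first.
  rewrite !mulr0 addr0; have [->|xy] := eqVneq x y; last first.
    by rewrite mulr0n (off_diag hs hq).
  by rewrite mulr1n (diag_axis hs hq)// (diag_perm hq y0 i10).
have [->|x0] := eqVneq x ord0; last by rewrite mulr0n add0r column//; ring.
rewrite mulr1n (diag_axis hs hq)//.
by apply/eqP; rewrite addrC -subr_eq BA; apply/eqP; ring.
Qed.

End Structure.

(** * ** * Comparison with the explicit kernels *)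

Section Expansion.
Variables (R : realType) (n : nat).
Local Notation C := R[i].
Local Notation N := (@normc R).
Local Notation rc := (real_complex R).

(** A unitary moving [w] to the axis preserves the inner product, and conjugation by it respects
    both [1%:M] and [z *m adjmx w]; the same coefficients therefore serve everywhere. *)
Lemma structure (K : 'cV[C]_n.+1 -> 'cV[C]_n.+1 -> 'M[C]_n.+1) :
  sesqui_analytic K -> hermitian_kernel K -> quasi_invariant_id K ->
  exists a g : nat -> C, forall z w, cball z -> cball w ->
    exists al ga, [/\ sums_to (fun k => a k * cinner z w ^+ k) al,
      sums_to (fun k => g k * cinner z w ^+ k) ga &
      K z w = al%:M + ga *: (z *m adjmx w)].
Proof.
move=> hs hh hq; have [a [g hag]] := structure_axis hs hh hq.
exists a, g => z w hz hw; have [u [c [hu wE]]] := unitary_axis w.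
have hu' := unitary_adj hu; pose z' := adjmx u *m z.
have hz' : cball z' by exact: cball_unitary.
have uz' : u *m z' = z by rewrite mulmxA hu mul1mx.
have hc : cball (axis n c).
  have -> : axis n c = adjmx u *m w by rewrite wE mulmxA unitary_adjK// mul1mx.
  exact: cball_unitary.
have c1 : N c < 1 by exact: (cball_axis n c).1 hc.
have [al [ga [h1 h2 KE]]] := hag _ _ hz' c1; exists al, ga.
have -> : cinner z w = z' ord0 0 * c^* by rewrite -cinner_axis -uz' wE cinner_unitary.
split; [exact: h1|exact: h2|]; rewrite -uz' wE (quasi hq hu hz' hc) KE mulmxDr mulmxDl; congr (_ + _).
  by rewrite mul_mx_scalar -scalemxAl hu scalemx1.
by rewrite -scalemxAr -scalemxAl adjmxM !mulmxA.
Qed.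

Lemma normc_cinner d (z w : 'cV[C]_d) : cball z -> cball w -> N (cinner z w) < 1.
Proof.
move=> /cballE hz /cballE hw; rewrite (le_lt_trans (normc_sum _ _))//.
apply: (@le_lt_trans _ _ ((\sum_i N (z i 0) ^+ 2 + \sum_i N (w i 0) ^+ 2) / 2)); last by lra.
rewrite -big_split mulr_suml; apply: ler_sum => i _; rewrite normcM normc_conj /=.
by have := sqr_ge0 (N (z i 0) - N (w i 0)); lra.
Qed.

(** Bounded terms at a radius halfway between [N t] and [1] give geometric decay at [t]. Such decay,
    unlike mere convergence, survives multiplication of the coefficients by bounded factors. *)
Lemma coef_decay (a : nat -> C) t : N t < 1 ->
  (forall r, 0 < r -> r < 1 -> exists l, sums_to (fun k => a k * rc r ^+ k) l) ->
  exists2 x, 0 <= x < 1 & exists M, forall k, N (a k * t ^+ k) <= M * x ^+ k.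
Proof.
move=> t1 ha; pose r := (1 + N t) / 2; have t0 := normc_ge0 t.
have r0 : 0 < r by rewrite /r; lra.
have r1 : r < 1 by rewrite /r; lra.
have [l hl] := ha r r0 r1; have [M M0 hM] := coef_bound r0 hl.
exists (r^-1 * N t).
  by rewrite mulr_ge0 ?invr_ge0 ?(ltW r0)//= mulrC ltr_pdivrMr// mul1r /r; lra.
by exists M => k; rewrite normcM normcX exprMn mulrA ler_wpM2r ?exprn_ge0.
Qed.

(** In [Khat j] the coefficient of [cinner z w ^+ j] times the identity is the inverse of [j]
    factorial, hence the normalisation. With [j = l + 1] and dimension [n + 1], the number
    [l + n.+1] is degree plus dimension minus one. *)
Lemma Khat_expansion (a : nat -> C) z w j :
  (a j * j`!%:R) *: Khat j z w = (a j * cinner z w ^+ j) *: 1%:M +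
    (if j is l.+1 then - (a l.+1 * (l.+1%:R / (l + n.+1)%:R) * cinner z w ^+ l) else 0)
      *: (z *m adjmx w) :> 'M[C]_n.+1.
Proof.
case: j => [|l]; first by rewrite /= scale0r addr0 expr0.
have d0 : (l + n.+1)%:R != 0 :> C by rewrite pnatr_eq0 addnS.
have f0 : l`!%:R != 0 :> C by rewrite pnatr_eq0 -lt0n fact_gt0.
have l0 : l.+1%:R != 0 :> C by rewrite pnatr_eq0.
rewrite [Khat _ _ _]/= factS natrM exprS; set t := cinner z w.
rewrite !scalerBr !scalerA -scaleNr; congr (_ *: _ + _ *: _).
  move: (l + n.+1)%:R l.+1%:R l`!%:R (t ^+ l) d0 f0 l0 => D L F T D0 F0 L0.
  by field; rewrite D0 F0 L0.
move: (l + n.+1)%:R l.+1%:R l`!%:R (t ^+ l) d0 f0 l0 => D L F T D0 F0 L0.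
by field; rewrite D0 F0.
Qed.

Lemma Khatperp_expansion (c : C) (z w : 'cV[C]_n.+1) l :
  (c * ((l + n.+1)%:R * l`!%:R)) *: Khatperp l.+1 z w =
    (c * cinner z w ^+ l) *: (z *m adjmx w).
Proof.
have d0 : (l + n.+1)%:R != 0 :> C by rewrite pnatr_eq0 addnS.
have f0 : l`!%:R != 0 :> C by rewrite pnatr_eq0 -lt0n fact_gt0.
rewrite /= scalerA; congr (_ *: _); set t := cinner z w.
move: (l + n.+1)%:R l`!%:R (t ^+ l) d0 f0 => D F T D0 F0.
by field; rewrite D0 F0.
Qed.

Lemma expansion (K : 'cV[C]_n.+1 -> 'cV[C]_n.+1 -> 'M[C]_n.+1) :
  sesqui_analytic K -> hermitian_kernel K -> quasi_invariant_id K ->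
  exists (alpha beta : nat -> C),
    forall z w, cball z -> cball w ->
      exists L1 L2 : 'M[C]_n.+1,
        [/\ [series alpha j *: Khat j z w]_j @ \oo --> L1,
            [series beta j.+1 *: Khatperp j.+1 z w]_j @ \oo --> L2 &
            K z w = L1 + L2].
Proof.
move=> hs hh hq; have [a [g hag]] := structure hs hh hq.
pose q l : C := a l.+1 * (l.+1%:R / (l + n.+1)%:R).
(* [alpha] is read off the coefficient of the identity matrix; [q] is then the
   contribution of [alpha] to [z w^*], which [beta] must compensate. *)
exists (fun j => a j * j`!%:R).
exists (fun j => (g j.-1 + q j.-1) * ((j.-1 + n.+1)%:R * j.-1`!%:R)).
move=> z w hz hw; have [al [ga [hal hga KE]]] := hag z w hz hw.
have t1 := normc_cinner hz hw.
have [x /andP[x0 x1] [M hM]] : exists2 x, 0 <= x < 1 &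
    exists M, forall k, N (a k.+1 * cinner z w ^+ k) <= M * x ^+ k.
  apply: (@coef_decay (fun k => a k.+1)) => // r r0 r1.
  (* The axis points [r'] and [r / r'] lie in the ball, as [r < r' < 1], and have inner product [r];
     so the series [a] converges at every such [r]. *)
  pose r' := (1 + r) / 2; have r'0 : 0 < r' by rewrite /r'; lra.
  have hz1 : cball (axis n (rc r')).
    by apply/cball_axis; rewrite normc_rc ger0_norm ?(ltW r'0)// /r'; lra.
  have hw1 : cball (axis n (rc (r / r'))).
    apply/cball_axis; rewrite normc_rc ger0_norm; last by rewrite divr_ge0 ?ltW.
    by rewrite ltr_pdivrMr// /r'; lra.
  have [l [_ [hl _ _]]] := hag _ _ hz1 hw1; move: hl.
  rewrite cinner_axis axisE eqxx -[_^*]/(conjc _) conjc_rc -rmorphM mulrCA mulfV ?lt0r_neq0// mulr1.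
  by move=> /series_split[m hm _]; exists m.
have [m hm] : exists m, sums_to (fun l => q l * cinner z w ^+ l) m.
  apply: (geometric_sums x0 x1) => l; apply: le_trans (hM l).
  rewrite /q mulrAC normcM ler_piMr ?normc_ge0//.
  rewrite (_ : _ / _ = rc (l.+1%:R / (l + n.+1)%:R)); last by rewrite fmorph_div !rmorph_nat.
  rewrite normc_rc ger0_norm ?divr_ge0// ler_pdivrMr ?ltr0n ?addnS//.
  by rewrite mul1r ler_nat ltnS leq_addr.
(* The [Khat] series overshoots by [- m] times [z w^*], and the [Khatperp] series returns this
   amount. *)
exists (al *: 1%:M + (- m) *: (z *m adjmx w)), (ga *: (z *m adjmx w) + m *: (z *m adjmx w)).
split.
- have hv : sums_to (fun j => if j is l.+1 then - (q l * cinner z w ^+ l) else 0) (- m).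
    rewrite -[- m]add0r; apply: (@sums_to_unshift _ (fun j =>
      if j is l.+1 then - (q l * cinner z w ^+ l) else 0)).
    by have := sums_toZ (-1) hm; rewrite mulN1r; under eq_fun do rewrite mulN1r.
  by apply: (series_mx_cvg hal hv) => j; exact: Khat_expansion.
- apply: (series_mx_cvg hga hm) => l.
  by rewrite Khatperp_expansion -scalerDl mulrDl.
- by rewrite KE scaleNr addrACA addNr addr0 scalemx1.
Qed.

End Expansion.

Theorem theorem3p10 (R : realType) (d : nat)
    (K : 'cV[R[i]]_d -> 'cV[R[i]]_d -> 'M[R[i]]_d) :
  sesqui_analytic K -> hermitian_kernel K -> quasi_invariant_id K ->
  exists (alpha beta : nat -> R[i]),
    forall z w, cball z -> cball w ->
      exists L1 L2 : 'M[R[i]]_d,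
        [/\ [series alpha j *: Khat j z w]_j @ \oo --> L1,
            [series beta j.+1 *: Khatperp j.+1 z w]_j @ \oo --> L2 &
            K z w = L1 + L2].
Proof.
case: d K => [|n] K; last exact: expansion.
(* In dimension zero there is only one matrix, so any coefficients do. *)
move=> _ _ _; exists (fun=> 0), (fun=> 0) => z w _ _; exists 0, 0.
have cvg0 (S : nat -> 'M[R[i]]_0) : [series S j]_j @ \oo --> (0 : 'M[R[i]]_0).
  rewrite (_ : [series S j]_j = fun=> 0); first exact: cvg_cst.
  by apply/funext => m; exact: flatmx0.
by split=> //; rewrite [LHS]flatmx0 addr0.
Qed.
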